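(* Let $K$ be a non-Archimedean local field (a finite extension of $\mathbb{Q}_p$ or of $\mathbb{F}_p((t))$) and let $f\in\mathcal{A}_K[1,1]$. Assume that the set $$\{\xi\in\mu_\infty : f(\xi)\in\mu_\infty\}$$ is infinite. Then $f$ is special.
   Context: Let $|\cdot|$ denote the absolute value of $K$, extended to a fixed algebraically closed field $\Omega$ containing $K$ that is complete with respect to an extension of $|\cdot|$ (the completion of an algebraic closure of $K$; it is $\mathbb{C}_p$ in characteristic $0$). $\mu_\infty$ denotes the group of all roots of unity in $\Omega$. $\mathcal{A}_K[1,1]$ denotes the set of Laurent series $f=\sum_{n\in\mathbb{Z}} f_nX^n$ with $f_n\in K$ such that $|f_n|\to 0$ as $|n|\to\infty$ (i.e. $f$ converges on the unit sphere $\{|x|=1\}$); for $x\in\Omega$ with $|x|=1$, $f(x)=\sum_n f_nx^n$. Such an $f$ is called special if either $K$ has characteristic $0$ and $f(X)=\eta X^m$ for some $\eta\in\mu_\infty$ and $m\in\mathbb{Z}$, or $K$ has characteristic $p>0$ and $f\in\overline{\mathbb{F}}_p[X,X^{-1}]$ (a Laurent polynomial whose coefficients are algebraic over $\mathbb{F}_p$). *)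

(* Defs.v *)
From HB Require Import structures.
From mathcomp Require Import all_boot all_order all_algebra.
From mathcomp Require Import reals.
Set Implicit Arguments. Unset Strict Implicit. Unset Printing Implicit Defensive.
Import Order.TTheory GRing.Theory Num.Theory.
Local Open Scope ring_scope.

Section Defs.
Variables (R : realType) (Om : closedFieldType) (v : Om -> R).

Definition nonarch_abs : Prop :=
  [/\ (forall x, 0 <= v x),
      (forall x, v x = 0 <-> x = 0),
      (forall x y, v (x * y) = v x * v y) &
      (forall x y, v (x + y) <= Num.max (v x) (v y))].

Definition cvg_to (u : nat -> Om) (l : Om) : Prop :=
  forall e : R, 0 < e -> exists N : nat, forall n, (N <= n)%N -> v (u n - l) < e.

Definition cauchy (u : nat -> Om) : Prop :=
  forall e : R, 0 < e -> exists N : nat,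
    forall m n, (N <= m)%N -> (N <= n)%N -> v (u m - u n) < e.

Definition complete_abs : Prop :=
  forall u, cauchy u -> exists l, cvg_to u l.

Definition is_subfield (K : pred Om) : Prop :=
  [/\ 0 \in K, 1 \in K,
      (forall x y, x \in K -> y \in K -> x - y \in K),
      (forall x y, x \in K -> y \in K -> x * y \in K) &
      (forall x, x \in K -> x^-1 \in K)].

(* K, with the restriction of v, is a non-Archimedean local field:
   complete, discretely valued (nontrivially), with finite residue field. *)
Definition is_local_field (K : pred Om) : Prop :=
  [/\ is_subfield K,
      (forall u, (forall n, u n \in K) -> cauchy u ->
           exists2 l, l \in K & cvg_to u l),
      (exists2 pi, pi \in K &
         (0 < v pi < 1) /\
         (forall x, x \in K -> x != 0 -> exists z : int, v x = v pi ^ z)) &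
      (exists s : seq Om, all (fun a => (a \in K) && (v a <= 1)) s /\
         forall x, x \in K -> v x <= 1 -> exists2 a, a \in s & v (x - a) < 1)].

Definition algebraic_over (K : pred Om) (x : Om) : Prop :=
  exists p : {poly Om}, [/\ p != 0, (forall i, p`_i \in K) & root p x].

(* Om is the completion of an algebraic closure of K:
   the elements algebraic over K are dense in Om *)
Definition alg_dense (K : pred Om) : Prop :=
  forall w : Om, forall e : R, 0 < e ->
    exists2 y, algebraic_over K y & v (w - y) < e.

Definition in_mu_inf (x : Om) : Prop :=
  exists n : nat, (0 < n)%N /\ x ^+ n = 1.

(* f = sum_n f_n X^n is in A_K[1,1] *)
Definition in_A11 (K : pred Om) (f : int -> Om) : Prop :=
  (forall n, f n \in K) /\
  (forall e : R, 0 < e -> exists N : nat, forall n : int, (N < `|n|)%N -> v (f n) < e).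

Definition partial_sum (f : int -> Om) (x : Om) (N : nat) : Om :=
  \sum_(i < (N.*2).+1) f (i%:Z - N%:Z) * x ^ (i%:Z - N%:Z).

Definition eval_to (f : int -> Om) (x y : Om) : Prop :=
  cvg_to (partial_sum f x) y.

Definition algebraic_over_prime (x : Om) : Prop :=
  exists p : {poly Om},
    [/\ p != 0, (forall i, exists k : nat, p`_i = k%:R) & root p x].

Definition special (f : int -> Om) : Prop :=
  ([pchar Om] =i pred0 /\
     exists eta : Om, exists m : int,
       in_mu_inf eta /\ forall n, f n = if n == m then eta else 0)
  \/
  ((exists p : nat, p \in [pchar Om]) /\
     (exists N : nat, forall n : int, (N < `|n|)%N -> f n = 0) /\
     (forall n, algebraic_over_prime (f n))).

End Defs.

(* Main.v *)
(* Let p be the residue characteristic and call a root of unity tame if its order is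
   prime to p; distinct tame roots are at distance 1, so a Laurent series that is small at
   infinitely many tame roots of unity has small coefficients.

   In characteristic p every root of unity is tame. Lifting the coefficients of f modulo the
   maximal ideal to elements b_n algebraic over F_p, the series f - sum b_n X^n takes values that
   are algebraic over F_p and of absolute value < 1, hence 0, at infinitely many roots of unity;
   so f = sum b_n X^n.

   In characteristic 0 let t be a primitive root of unity of order p^s r with p not dividing r.
   Ramification shows that t^a is conjugate to t over K for all a = 1 mod r p^C, with C depending
   only on K. If f(x) = y with x of order divisible by a high power of p, conjugating gives
   f(x z^l) = y w^l for all l, with z of large order N; Fourier inversion over mu_N shows that
   f_j is nonzero only if w = z^j, so f is a monomial. If the p-parts of the orders stay bounded,
   a Frobenius conjugation gives g(x^Q) = g(x)^Q at infinitely many tame roots, for g a twist of f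
   and Q any of arbitrarily large powers of p; this identity extends to |x| = 1 and produces
   values in mu_oo at roots of unity of arbitrarily large p-power order, the previous case. *)
Require Import Defs.
From HB Require Import structures.
From mathcomp Require Import all_boot all_order all_algebra.
From mathcomp Require Import cyclic separable cyclotomic.
From mathcomp Require Import boolp reals zify ring lra.
Import Order.TTheory GRing.Theory Num.Theory.
Local Open Scope ring_scope.
Set Implicit Arguments. Unset Strict Implicit. Unset Printing Implicit Defensive.

(** * Calculus of a non-Archimedean absolute value *)

Section NonArch.
Variables (R : realType) (Om : closedFieldType) (v : Om -> R).
Hypothesis Hv : nonarch_abs v.

Lemma v_ge0 x : 0 <= v x. Proof. by case: Hv => h _ _ _; exact: h. Qed.
Lemma v_eq0 x : (v x == 0) = (x == 0).
Proof. by case: Hv => _ h _ _; apply/eqP/eqP => /h. Qed.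
Lemma v0 : v 0 = 0. Proof. by apply/eqP; rewrite v_eq0. Qed.
Lemma vM x y : v (x * y) = v x * v y. Proof. by case: Hv => _ _ h _; exact: h. Qed.
Lemma v_gt0 x : (0 < v x) = (x != 0).
Proof. by rewrite lt_def v_ge0 andbT v_eq0. Qed.

Lemma v1 : v 1 = 1.
Proof.
have h : v 1 != 0 by rewrite v_eq0 oner_eq0.
by apply: (mulfI h); rewrite -vM !mulr1.
Qed.

Lemma vX x n : v (x ^+ n) = v x ^+ n.
Proof. by elim: n => [|n IH]; rewrite ?expr0 ?v1 // !exprS vM IH. Qed.

Lemma v_unity x n : (0 < n)%N -> x ^+ n = 1 -> v x = 1.
Proof.
move=> n0 /(congr1 v); rewrite vX v1 => h.
by apply/eqP; rewrite -(@pexpr_eq1 _ _ n) ?v_ge0 ?h.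
Qed.

Lemma vN x : v (- x) = v x.
Proof. by rewrite -mulN1r vM (@v_unity _ 2) ?mul1r // sqrrN expr1n. Qed.

Lemma vV x : v x^-1 = (v x)^-1.
Proof.
have [->|x0] := eqVneq x 0; first by rewrite invr0 v0 invr0.
have h : v x != 0 by rewrite v_eq0.
by apply: (mulfI h); rewrite -vM !divff // v1.
Qed.

Lemma vXz x (n : int) : v (x ^ n) = v x ^ n.
Proof. by case: n => n; rewrite ?NegzE -?exprnN ?vV vX. Qed.

Lemma vC x y : v (x - y) = v (y - x).
Proof. by rewrite -vN opprB. Qed.

Lemma vD_le d x y : v x <= d -> v y <= d -> v (x + y) <= d.
Proof.
move=> hx hy; case: Hv => _ _ _ h; apply: le_trans (h _ _) _.
by rewrite ge_max hx.
Qed.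

Lemma vB_le d x y : v x <= d -> v y <= d -> v (x - y) <= d.
Proof. by move=> hx hy; apply: vD_le; rewrite ?vN. Qed.

Lemma vD_lt d x y : v x < d -> v y < d -> v (x + y) < d.
Proof.
move=> hx hy; case: Hv => _ _ _ h; apply: le_lt_trans (h _ _) _.
by rewrite gt_max hx.
Qed.

Lemma vB_lt d x y : v x < d -> v y < d -> v (x - y) < d.
Proof. by move=> hx hy; apply: vD_lt; rewrite ?vN. Qed.

Lemma v_dist_le d y x z : v (x - y) <= d -> v (y - z) <= d -> v (x - z) <= d.
Proof. by move=> h1 h2; rewrite -(subrKA y); apply: vD_le. Qed.

Lemma v_dist_lt d y x z : v (x - y) < d -> v (y - z) < d -> v (x - z) < d.
Proof. by move=> h1 h2; rewrite -(subrKA y); apply: vD_lt. Qed.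

Lemma v_sum_le (I : Type) (r : seq I) (P : pred I) (F : I -> Om) d :
  0 <= d -> (forall i, P i -> v (F i) <= d) -> v (\sum_(i <- r | P i) F i) <= d.
Proof.
by move=> d0 h; elim/big_ind: _ => //; [rewrite v0 | move=> x y; exact: vD_le].
Qed.

Lemma v_sum_lt (I : Type) (r : seq I) (P : pred I) (F : I -> Om) d :
  0 < d -> (forall i, P i -> v (F i) < d) -> v (\sum_(i <- r | P i) F i) < d.
Proof.
by move=> d0 h; elim/big_ind: _ => //; [rewrite v0 | move=> x y; exact: vD_lt].
Qed.

Lemma v_prod (I : Type) (r : seq I) (P : pred I) (F : I -> Om) :
  v (\prod_(i <- r | P i) F i) = \prod_(i <- r | P i) v (F i).
Proof. by apply: (big_morph v vM v1). Qed.

Lemma v_prod_lt1 (I : eqType) (s : seq I) (F : I -> Om) :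
  v (\prod_(i <- s) F i) < 1 -> exists2 i, i \in s & v (F i) < 1.
Proof.
elim: s => [|i s IH]; first by rewrite big_nil v1 ltxx.
rewrite big_cons vM; have [lt _|ge h] := ltP (v (F i)) 1.
  by exists i; rewrite ?mem_head.
have [|j js hj] := IH; last by exists j; rewrite // inE js orbT.
by apply: le_lt_trans h; rewrite ler_peMl ?v_ge0.
Qed.

Lemma v_nat n : v n%:R <= 1.
Proof.
elim: n => [|n IH]; first by rewrite v0 ler01.
by rewrite -natr1; apply: vD_le => //; rewrite v1.
Qed.

Lemma vX_le1 x n : v x <= 1 -> v (x ^+ n) <= 1.
Proof. by move=> h; rewrite vX exprn_ile1 // v_ge0. Qed.

Lemma v_eps0 x : (forall e, 0 < e -> v x <= e) -> x = 0.
Proof.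
move=> h; apply/eqP; rewrite -v_eq0 eq_le v_ge0 andbT.
by apply/ler_addgt0Pr => e e0; rewrite add0r h.
Qed.

Lemma cvg_to_uniq u l l' : cvg_to v u l -> cvg_to v u l' -> l = l'.
Proof.
move=> h h'; apply/eqP; rewrite -subr_eq0; apply/eqP/v_eps0 => e e0.
have [N hN] := h e e0; have [N' hN'] := h' e e0.
apply: (@v_dist_le _ (u (maxn N N'))); apply/ltW.
  by rewrite vC hN // leq_maxl.
by rewrite hN' // leq_maxr.
Qed.

Lemma v_powB x y B n : 1 <= B -> v x <= B -> v y <= B ->
  v (x ^+ n - y ^+ n) <= v (x - y) * B ^+ n.
Proof.
move=> B1 hx hy; have B0 : 0 <= B by rewrite (le_trans ler01).
rewrite subrXX vM ler_wpM2l ?v_ge0 //; apply: v_sum_le; first exact: exprn_ge0.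
move=> i _; rewrite vM !vX.
apply: le_trans (_ : B ^+ (n.-1 - i) * B ^+ i <= _).
  have pw z k : v z <= B -> 0 <= v z ^+ k <= B ^+ k.
    by move=> hz; rewrite exprn_ge0 ?v_ge0 //= lerXn2r // nnegrE v_ge0.
  have /andP[? ?] := pw x (n.-1 - i)%N hx; have /andP[? ?] := pw y i hy.
  exact: ler_pM.
rewrite -exprD ler_weXn2l //; have := ltn_ord i; lia.
Qed.

(** * Polynomials at points with unit distances *)

Lemma v_horner_le (P : {poly Om}) d x :
  0 <= d -> (forall i, v P`_i <= d) -> v x <= 1 -> v P.[x] <= d.
Proof.
move=> d0 hP hx; rewrite horner_coef; apply: v_sum_le => // i _.
by rewrite vM -[d]mulr1 ler_pM ?v_ge0 // vX_le1.
Qed.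

(** A Vandermonde matrix at points with unit distances has a determinant of absolute value 1.
    Concretely, divide P - P(x) by X - x: at every other point y the divisor y - x is a unit, so the
    quotient obeys the same bound, and induction on [s] applies to it. *)
Lemma coef_le_of_values (d : R) (s : seq Om) (P : {poly Om}) :
  0 <= d -> (size P <= size s)%N -> uniq s ->
  {in s, forall x, v x <= 1} -> {in s &, forall x y, x != y -> v (x - y) = 1} ->
  {in s, forall x, v P.[x] <= d} -> forall i, v P`_i <= d.
Proof.
move=> d0; elim: s P => [|x s IH] P /= hsz.
  by move=> _ _ _ _ i; rewrite nth_default ?v0 // (leq_trans hsz).
case/andP=> xs us h1 h2 hP.
have [Q hQ] : exists Q, P - P.[x]%:P = Q * ('X - x%:P).
  by apply/factor_theorem; rewrite /root !hornerE subrr.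
have PE : P = P.[x]%:P + Q * ('X - x%:P) by rewrite -hQ subrKC.
have xin : x \in x :: s by rewrite mem_head.
have sub y : y \in s -> y \in x :: s by rewrite inE orbC => ->.
have hQs : (size Q <= size s)%N.
  have [->|Q0] := eqVneq Q 0; first by rewrite size_poly0.
  have : (size (Q * ('X - x%:P))%R <= (size s).+1)%N.
    rewrite -hQ; apply: leq_trans (size_polyD _ _) _.
    by rewrite size_polyN geq_max hsz (leq_trans (size_polyC_leq1 _)).
  by rewrite size_mul ?polyXsubC_eq0 // size_XsubC addn2.
have hQv : {in s, forall y, v Q.[y] <= d}.
  move=> y ys; have yx : y != x by apply: contraNneq xs => <-.
  have : v (P.[y] - P.[x]) <= d by apply: vB_le; apply: hP => //; exact: sub.
  rewrite {1}PE !hornerE addrC addKr vM.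
  by rewrite (h2 _ _ (sub _ ys) xin yx) mulr1.
have hQc := IH Q hQs us (fun y ys => h1 y (sub _ ys))
  (fun y z ys zs => h2 y z (sub _ ys) (sub _ zs)) hQv.
move=> i; rewrite PE coefD coefC mulrBr coefB coefMC coefMX.
have hx : v (Q`_i * x) <= d by rewrite vM -[d]mulr1 ler_pM ?v_ge0 ?h1.
apply: vD_le; first by case: (i == 0); rewrite ?v0 ?hP.
by apply: vB_le => //; case: (i == 0); rewrite ?v0.
Qed.

(** The transposed Vandermonde system. Writing T_k for the k-th moment, T_(k+1) - x_j T_k eliminates
    the weight of j and multiplies each other weight by the unit x_i - x_j. *)
Lemma weights_le_of_moments (d : R) (I : eqType) (s : seq I) (x y : I -> Om) :
  uniq s -> {in s, forall i, v (x i) <= 1} ->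
  {in s &, forall i j, i != j -> v (x i - x j) = 1} -> 0 <= d ->
  (forall k, v (\sum_(i <- s) y i * x i ^+ k) <= d) ->
  {in s, forall i, v (y i) <= d}.
Proof.
elim: s y => [//|j s IH] y /= /andP[js us] h1 h2 d0 hT.
have jin : j \in j :: s by rewrite mem_head.
have sub i : i \in s -> i \in j :: s by rewrite inE orbC => ->.
have hs : {in s, forall i, v (y i * (x i - x j)) <= d}.
  apply: (IH (fun i => y i * (x i - x j))) => //.
  - by move=> i /sub /h1.
  - by move=> i k /sub hi /sub hk; exact: h2.
  move=> k.
  have -> : \sum_(i <- s) y i * (x i - x j) * x i ^+ k =
     \sum_(i <- j :: s) y i * x i ^+ k.+1 -
     x j * \sum_(i <- j :: s) y i * x i ^+ k.
    rewrite mulr_sumr -sumrB big_cons /= exprS mulrCA subrr add0r.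
    by apply: eq_bigr => i _; rewrite exprS; ring.
  by apply: vB_le; rewrite // vM -[d]mul1r ler_pM ?v_ge0 ?h1.
have hs' : {in s, forall i, v (y i) <= d}.
  move=> i si; have ij : i != j by apply: contraNneq js => <-.
  by have := hs i si; rewrite vM (h2 i j) // ?sub // mulr1.
move=> i; rewrite inE => /orP[/eqP->|]; last exact: hs'.
have := hT 0; rewrite big_cons expr0 mulr1.
under eq_bigr => k _ do rewrite expr0 mulr1.
move=> h; rewrite -[y j](addrK (\sum_(k <- s) y k)); apply: vB_le => //.
by rewrite big_seq_cond; apply: v_sum_le => // k; rewrite andbT => /hs'.
Qed.

(** * Roots of unity of order prime to the residue characteristic *)

(** The condition |r| = 1 says that r is prime to the residue characteristic without naming it, and
    it excludes r = 0. *)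
Definition tame_root (x : Om) : Prop := exists r : nat, v r%:R = 1 /\ x ^+ r = 1.

Lemma tame_gt0 r : v r%:R = 1 -> (0 < r)%N.
Proof. by case: r => // /eqP; rewrite v0 eq_sym oner_eq0. Qed.

(** If x differed from 1, the sum 1 + x + ... + x^(r-1) would vanish; but each term is congruent to
    1 modulo the maximal ideal, so the sum is congruent to the unit r. *)
Lemma tame_root_near1 x : tame_root x -> v (x - 1) < 1 -> x = 1.
Proof.
case=> r [hr xr] hx; apply/eqP; apply: contraTT isT => x1.
have: \sum_(i < r) x ^+ i = 0.
  apply/eqP; have /eqP : (x - 1) * (\sum_(i < r) x ^+ i) = 0.
    by rewrite -subrX1 xr subrr.
  by rewrite mulf_eq0 subr_eq0 (negbTE x1).
move=> h0; have : v (r%:R - \sum_(i < r) x ^+ i) < 1.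
  rewrite -[r in r%:R]card_ord -sumr_const -sumrB; apply: v_sum_lt => // i _.
  rewrite vC subrX1 vM; apply: le_lt_trans hx.
  rewrite -[leRHS]mulr1 ler_wpM2l ?v_ge0 //; apply: v_sum_le => // j _.
  by rewrite vX_le1 // (v_unity _ xr) ?(tame_gt0 hr).
by rewrite h0 subr0 hr ltxx.
Qed.

Lemma tame_rootM x y : tame_root x -> tame_root y -> tame_root (x * y).
Proof.
move=> [r [hr xr]] [t [ht yt]]; exists (r * t)%N; split.
  by rewrite natrM vM hr ht mulr1.
by rewrite exprMn exprM xr mulnC exprM yt !expr1n mulr1.
Qed.

Lemma tame_rootX x n : tame_root x -> tame_root (x ^+ n).
Proof. by move=> [r [hr xr]]; exists r; rewrite exprAC xr expr1n. Qed.

Lemma tame_rootV x : tame_root x -> tame_root x^-1.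
Proof. by move=> [r [hr xr]]; exists r; rewrite exprVn xr invr1. Qed.

Lemma v_tame x : tame_root x -> v x = 1.
Proof. by move=> [r [hr xr]]; apply: v_unity xr; exact: tame_gt0. Qed.

Lemma tame_root_close x y : tame_root x -> tame_root y -> v (x - y) < 1 -> x = y.
Proof.
move=> hx hy h; have y0 : y != 0 by rewrite -v_gt0 v_tame.
apply: (divIf y0); rewrite divff //; apply: tame_root_near1.
  by apply: tame_rootM => //; exact: tame_rootV.
by rewrite -(divff y0) -mulrBl vM vV (v_tame hy) invr1 mulr1.
Qed.

Lemma tame_root_dist x y : tame_root x -> tame_root y -> x != y -> v (x - y) = 1.
Proof.
move=> hx hy xy; apply/eqP; rewrite eq_le; apply/andP; split.
  by apply: vB_le; rewrite v_tame.
by rewrite leNgt; apply: contraNN xy => h; apply/eqP/tame_root_close.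
Qed.

Lemma inf_uniq (P : Om -> Prop) n :
  (forall s : seq Om, exists x, x \notin s /\ P x) ->
  exists s, [/\ size s = n, uniq s & {in s, forall x, P x}].
Proof.
move=> h; elim: n => [|n [s [sz us hs]]]; first by exists [::].
have [x [xs Px]] := h s; exists (x :: s); split; rewrite /= ?sz ?xs //.
by move=> y; rewrite inE => /orP[/eqP->|/hs].
Qed.

Lemma coef_le_of_tame_values (P : {poly Om}) d : 0 <= d ->
  (forall s : seq Om, exists x, x \notin s /\ (tame_root x /\ v P.[x] <= d)) ->
  forall i, v P`_i <= d.
Proof.
move=> d0 h; have [s [sz us hs]] := inf_uniq (size P) h.
apply: (coef_le_of_values (s := s)) => //; first by rewrite sz.
- by move=> x /hs [/v_tame->].
- by move=> x y /hs [hx _] /hs [hy _]; exact: tame_root_dist.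
- by move=> x /hs [].
Qed.

(** Infinite means here: not contained in any finite list. If the label u occurs only within a list
    [s0], then avoiding [s0] leaves the remaining labels. *)
Lemma pigeonhole_inf (T U : eqType) (Q : T -> U -> Prop) (l : seq U) :
  (forall s : seq T, exists x, x \notin s /\ exists2 u, u \in l & Q x u) ->
  exists2 u, u \in l & forall s : seq T, exists x, x \notin s /\ Q x u.
Proof.
elim: l => [|u l IH] h; first by have [x [_ []]] := h [::].
have [hu|] := pselect (forall s : seq T, exists x, x \notin s /\ Q x u).
  by exists u; rewrite ?mem_head.
move/existsNP => [s0 hs0].
have [s|w wl hw] := IH; last by exists w => //; rewrite inE wl orbT.
have [x [xs [w]]] := h (s ++ s0); move: xs.
rewrite mem_cat negb_or => /andP[xs xs0]; rewrite inE => /orP[/eqP->|wl] Qw.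
  by case: hs0; exists x.
by exists x; split => //; exists w.
Qed.

End NonArch.

(** * Laurent series on the unit sphere *)

Section Laurent.
Variables (R : realType) (Om : closedFieldType) (v : Om -> R).
Hypothesis Hv : nonarch_abs v.
Implicit Types (f : int -> Om) (x y : Om).

Definition tends0 (f : int -> Om) : Prop :=
  forall e : R, 0 < e -> exists N : nat, forall n : int, (N < `|n|)%N -> v (f n) < e.

Lemma partial_sumS f x N : partial_sum f x N.+1 =
  partial_sum f x N + (f (- N.+1%:Z) * x ^ (- N.+1%:Z) + f N.+1%:Z * x ^ N.+1%:Z).
Proof.
rewrite /partial_sum doubleS big_ord_recl big_ord_recr /= addrCA.
congr (_ + (_ + _)).
- by apply: eq_bigr => i _; do ![congr (_ * _) | congr (f _) | congr (x ^ _)]; rewrite /bump /=; lia.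
- by rewrite sub0r.
- by do ![congr (_ * _) | congr (f _) | congr (x ^ _)]; rewrite /bump /=; lia.
Qed.

Lemma partial_sum_tail f x D e N : v x = 1 -> 0 < e ->
  (forall n : int, (D < `|n|)%N -> v (f n) < e) -> (D <= N)%N ->
  v (partial_sum f x N - partial_sum f x D) < e.
Proof.
move=> hx e0 hf; elim: N => [|N IH].
  by rewrite leqn0 => /eqP->; rewrite subrr v0.
rewrite leq_eqVlt => /orP[/eqP->|]; first by rewrite subrr v0.
rewrite ltnS => DN; rewrite partial_sumS addrAC.
have vt n : (D < `|n|)%N -> v (f n * x ^ n) < e.
  by move=> hn; rewrite vM // vXz // hx exp1rz mulr1; exact: hf.
by apply: vD_lt; [|exact: IH |apply: vD_lt => //; apply: vt; lia].
Qed.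

Lemma eval_approx f x y D e : eval_to v f x y -> v x = 1 -> 0 < e ->
  (forall n : int, (D < `|n|)%N -> v (f n) < e) -> v (y - partial_sum f x D) < e.
Proof.
move=> hy hx e0 hf; have [N hN] := hy e e0.
apply: (v_dist_lt Hv (y := partial_sum f x (maxn N D))).
  by rewrite vC // hN // leq_maxl.
by apply: partial_sum_tail => //; rewrite leq_maxr.
Qed.

Lemma eval_to_exists f x : complete_abs v -> tends0 f -> v x = 1 ->
  exists y, eval_to v f x y.
Proof.
move=> cv hf hx; apply: cv => e e0; have [D hD] := hf e e0.
exists D => m n Dm Dn; apply: (v_dist_lt Hv (y := partial_sum f x D)).
  exact: partial_sum_tail.
by rewrite vC //; exact: partial_sum_tail.
Qed.

(** The truncation of f to |n| <= D, multiplied by X^D to become a polynomial; on the unit sphere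
    this factor does not change absolute values. *)
Definition shifted_trunc (f : int -> Om) D : {poly Om} :=
  \poly_(i < D.*2.+1) f (i%:Z - D%:Z).

Lemma partial_sum_horner f x D : x != 0 ->
  partial_sum f x D = x ^- D * (shifted_trunc f D).[x].
Proof.
move=> x0; rewrite horner_poly mulr_sumr; apply: eq_bigr => i _.
by rewrite expfzDr // -exprnN -exprnP mulrA mulrC.
Qed.

Lemma coef_shifted_trunc f D (n : int) : (`|n| <= D)%N ->
  (shifted_trunc f D)`_(absz (n + D%:Z)) = f n.
Proof.
move=> h; rewrite coef_poly; have -> : (absz (n + D%:Z)%R < D.*2.+1)%N by lia.
by congr f; lia.
Qed.

(** Cut f at a degree beyond which coefficients are below d and which is at least |n|: the
    truncation still has values at most d and still contains f_n. *)
Lemma coef_le_of_tame_evals f d : tends0 f -> 0 < d ->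
  (forall s : seq Om, exists w, w \notin s /\
     (tame_root v w /\ exists2 y, eval_to v f w y & v y <= d)) ->
  forall n, v (f n) <= d.
Proof.
move=> hf d0 h n; have [D0 hD] := hf d d0.
pose D := maxn D0 `|n|.
have {}hD m : (D < `|m|)%N -> v (f m) < d by move=> hm; apply: hD; lia.
rewrite -(@coef_shifted_trunc f D) ?leq_maxr //.
apply: (coef_le_of_tame_values Hv (ltW d0)) => s.
have [w [ws [tw [y hy hyd]]]] := h s; exists w; split=> //; split=> //.
have vw := v_tame Hv tw.
have w0 : w != 0 by rewrite -(v_gt0 Hv) vw.
have : v (partial_sum f w D) <= d.
  rewrite -[partial_sum _ _ _](subKr y); apply: vB_le => //.
  by apply/ltW/eval_approx.
by rewrite partial_sum_horner // vM // vV // vX // vw expr1n invr1 mul1r.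
Qed.

(** * The p-power map modulo the maximal ideal *)

Variable p : nat.
Hypothesis pP : prime p.
(** Every inner binomial coefficient is divisible by p and every inner term contains both x and y.
    The factor |x||y| is kept for the estimate of z^p - 1 in terms of z - 1. *)
Lemma v_powp_add x y : v x <= 1 -> v y <= 1 ->
  v ((x + y) ^+ p - (x ^+ p + y ^+ p)) <= v p%:R * (v x * v y).
Proof.
move=> hx hy; have p0 := prime_gt0 pP.
rewrite exprDn -(prednK p0) big_ord_recr big_ord_recl /= prednK //.
rewrite subn0 subnn expr0 mul1r mulr1 bin0 binn !mulr1n.
set S := \sum_(i < _) _; have -> : x ^+ p + S + y ^+ p - (x ^+ p + y ^+ p) = S by ring.
apply: v_sum_le => //; first by rewrite !mulr_ge0 ?v_ge0.
move=> i _; have ip := ltn_ord i.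
rewrite -mulr_natr /bump leq0n add1n.
have /dvdnP[k ->] : (p %| 'C(p, i.+1))%N by rewrite prime_dvd_bin //; lia.
have -> : (p - i.+1 = (p - i.+2).+1)%N by lia.
rewrite !exprS.
have -> : x * x ^+ (p - i.+2) * (y * y ^+ i) * (k * p)%:R =
   (x ^+ (p - i.+2) * y ^+ i * k%:R) * (p%:R * (x * y)) by rewrite natrM; ring.
rewrite vM // [v (_ * (x * y))]vM // [v (x * y)]vM // ler_piMl ?mulr_ge0 ?v_ge0 //.
by rewrite !vM // mulr_ile1 ?mulr_ge0 ?v_ge0 ?v_nat // mulr_ile1 ?v_ge0 ?vX_le1.
Qed.

Hypothesis vp : v p%:R < 1.

Lemma v_nat_coprime n : coprime p n -> v n%:R = 1.
Proof.
move=> cpn; apply/eqP; rewrite eq_le v_nat //= leNgt; apply/negP => hn.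
have p0 : (0 < p)%N by exact: prime_gt0.
case: (egcdnP n p0) => u w; rewrite (eqP cpn) => E _.
have : v (u * p)%:R < 1.
  by rewrite natrM vM //; apply: le_lt_trans vp; rewrite ler_piMl ?v_ge0 ?v_nat.
have : v (w * n)%:R < 1.
  by rewrite natrM vM //; apply: le_lt_trans hn; rewrite ler_piMl ?v_ge0 ?v_nat.
move=> h1 h2; have := vB_lt Hv h2 h1.
by rewrite E natrD addrC addKr v1 // ltxx.
Qed.

Lemma v_pchar_frobenius x y : v x <= 1 -> v y <= 1 ->
  v ((x + y) ^+ p - (x ^+ p + y ^+ p)) < 1.
Proof.
move=> hx hy; apply: le_lt_trans (v_powp_add hx hy) _; apply: le_lt_trans vp.
by rewrite ler_piMr ?v_ge0 // mulr_ile1 ?v_ge0.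
Qed.

(** Frobenius is additive and injective on the residue field. *)
Lemma v_powp_sub x y : v x <= 1 -> v y <= 1 ->
  (v (x ^+ p - y ^+ p) < 1) = (v (x - y) < 1).
Proof.
move=> hx hy.
have hxy : v (x - y) <= 1 by exact: vB_le.
have h := v_pchar_frobenius hxy hy; rewrite subrK in h.
have E : v ((x - y) ^+ p) < 1 = (v (x - y) < 1).
  by rewrite vX // expr_lt1 ?v_ge0 ?prime_gt0.
rewrite -E; apply/idP/idP => h'.
  by rewrite -[_ ^+ p](subKr (x ^+ p - y ^+ p)); apply: vB_lt => //; rewrite -addrA -opprD [y ^+ p + _]addrC.
by rewrite -[X in v X](subrK ((x - y) ^+ p)); apply: vD_lt => //; rewrite -addrA -opprD [y ^+ p + _]addrC.
Qed.

Lemma v_powpX_sub m x y : v x <= 1 -> v y <= 1 ->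
  (v (x ^+ (p ^ m) - y ^+ (p ^ m)) < 1) = (v (x - y) < 1).
Proof.
move=> hx hy; elim: m => [|m IH]; first by rewrite expn0 !expr1.
by rewrite expnSr !exprM v_powp_sub ?vX_le1.
Qed.

Lemma v_powpX_sum m n (F : 'I_n -> Om) : (forall i, v (F i) <= 1) ->
  v ((\sum_i F i) ^+ (p ^ m) - \sum_i F i ^+ (p ^ m)) < 1.
Proof.
move=> hF; have p0 := prime_gt0 pP.
have D x y k : v x <= 1 -> v y <= 1 ->
    v ((x + y) ^+ (p ^ k) - (x ^+ (p ^ k) + y ^+ (p ^ k))) < 1.
  move=> hx hy; elim: k => [|k IH]; first by rewrite expn0 !expr1 subrr v0.
  rewrite expnSr !exprM; have hx' := vX_le1 Hv (p ^ k) hx.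
  have hy' := vX_le1 Hv (p ^ k) hy.
  apply: (v_dist_lt Hv _ (v_pchar_frobenius hx' hy')).
  by rewrite v_powp_sub //; [rewrite vX_le1 // |]; exact: vD_le.
elim: n F hF => [|n IH] F hF.
  by rewrite !big_ord0 expr0n expn_eq0 gtn_eqF // subrr v0.
rewrite !big_ord_recr /=; set S := \sum_(i < n) _.
have hS : v S <= 1 by apply: v_sum_le.
apply: (v_dist_lt Hv (D S _ m hS (hF ord_max))).
rewrite opprD addrACA subrr addr0; exact: IH.
Qed.

Lemma v_unity_near1 z n : z ^+ (p ^ n) = 1 -> v (z - 1) < 1.
Proof.
move=> zn; have vz : v z = 1 by apply: v_unity zn => //; rewrite expn_gt0 prime_gt0.
by rewrite -(v_powpX_sub n) ?vz ?v1 // zn expr1n subrr v0.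
Qed.

End Laurent.

(** * Consequences of the finiteness of the residue field of K *)

Lemma residue_pigeonhole (R : realType) (Om : closedFieldType) (v : Om -> R)
    (K : pred Om) (s : seq Om) (c : nat -> Om) : nonarch_abs v ->
  (forall x, x \in K -> v x <= 1 -> exists2 a, a \in s & v (x - a) < 1) ->
  (forall i, c i \in K) -> (forall i, v (c i) <= 1) ->
  exists i j, [/\ (i < j)%N, (j <= size s)%N & v (c i - c j) < 1].
Proof.
move=> Hv hs cK c1; pose n := size s.
have /choice[g hg] : forall i : 'I_n.+1, exists k : 'I_n, v (c i - nth 0 s k) < 1.
  move=> i; have [a sa ha] := hs _ (cK i) (c1 i).
  have ka : (index a s < n)%N by rewrite index_mem.
  by exists (Ordinal ka); rewrite /= nth_index.
have /injectivePn[i [j ij gij]] : ~~ injectiveb g.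
  apply/negP => /injectiveP /leq_card; by rewrite !card_ord ltnn.
have h : v (c i - c j) < 1.
  by apply: (v_dist_lt Hv (hg i)); rewrite gij vC //; exact: hg.
have := ltn_ord i; have := ltn_ord j; rewrite !ltnS => jn iN.
case: (ltngtP i j) => [lij|lji|/ord_inj eij]; last by rewrite eij eqxx in ij.
  by exists i, j.
by exists j, i; rewrite vC.
Qed.

(** Two natural numbers share a residue, so some n > 0 has |n| < 1, and then so does one of its
    prime factors. *)
Lemma residue_char (R : realType) (Om : closedFieldType) (v : Om -> R)
    (K : pred Om) (s : seq Om) : nonarch_abs v ->
  (forall x, x \in K -> v x <= 1 -> exists2 a, a \in s & v (x - a) < 1) ->
  (forall n : nat, n%:R \in K) -> exists2 p, prime p & v p%:R < 1.
Proof.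
move=> Hv hs nK.
have [i [j [ij _ hij]]] := residue_pigeonhole (c := fun n => n%:R) Hv hs nK (v_nat Hv).
move: hij; rewrite vC // -natrB 1?ltnW // => h.
have n0 : (0 < j - i)%N by rewrite subn_gt0.
have : ~ (forall p, p \in primes (j - i) -> v p%:R = 1).
  move=> hp; move: h; rewrite (prod_prime_decomp n0) prime_decompE.
  rewrite big_map natr_prod v_prod // big_seq_cond big1 ?ltxx // => p.
  by rewrite andbT => pj; rewrite natrX vX // hp // expr1n.
move/existsNP => [p /not_implyP[pj hp]]; exists p.
  by move: pj; rewrite mem_primes => /andP[].
by rewrite lt_neqAle v_nat // andbT; apply/eqP.
Qed.

(** Among the iterated p-th powers of c two have the same residue; injectivity of Frobenius cancels
    the common part, leaving a period of at most [size s]. The factorial of [size s] is a multiple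
    of all such periods, hence independent of c. *)
Lemma residue_power (R : realType) (Om : closedFieldType) (v : Om -> R)
    (K : divringClosed Om) (s : seq Om) p : nonarch_abs v ->
  (forall x, x \in K -> v x <= 1 -> exists2 a, a \in s & v (x - a) < 1) ->
  prime p -> v p%:R < 1 ->
  exists2 m, (0 < m)%N & forall c, c \in K -> v c <= 1 -> v (c ^+ (p ^ m) - c) < 1.
Proof.
move=> Hv hs pP vp; exists (size s)`!; first exact: fact_gt0.
move=> c cK c1.
have [i [j [ij js]]] := residue_pigeonhole (c := fun i => c ^+ (p ^ i)) Hv hs
  (fun i => rpredX _ cK) (fun i => vX_le1 Hv _ c1).
rewrite -[in X in v (_ - X)](subnK (ltnW ij)) expnD exprM.
rewrite (v_powpX_sub Hv pP vp) ?vX_le1 // vC // => h.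
have /dvdnP[t ->] : (j - i %| (size s)`!)%N by rewrite dvdn_fact // subn_gt0 ij; lia.
elim: t => [|t IH]; first by rewrite mul0n expn0 expr1 subrr v0.
rewrite mulSn expnD exprM; apply: (v_dist_lt Hv) IH.
by rewrite (v_powpX_sub Hv pP vp) ?vX_le1.
Qed.

(** * Conjugation over a complete field *)

Section Conjugates.
Variables (R : realType) (Om : closedFieldType) (v : Om -> R).
Hypothesis Hv : nonarch_abs v.
Variable K : divringClosed Om.
Implicit Types (A B P : {poly Om}) (x y : Om).

Definition conj_over x y : Prop := forall A, A \is a polyOver K -> root A x -> root A y.

Lemma polyOver_mod_monic P A : P \is monic -> P \is a polyOver K ->
  A \is a polyOver K ->
  exists B C, [/\ B \is a polyOver K, C \is a polyOver K, A = B * P + C & (size C < size P)%N].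
Proof.
move=> Pm PK; have sP : (0 < size P)%N by rewrite size_poly_gt0 monic_neq0.
have [n] := ubnP (size A); elim: n A => // n IH A; rewrite ltnS => sA AK.
have [lt|ge] := ltnP (size A) (size P).
  by exists 0, A; rewrite rpred0 AK mul0r add0r; split.
have A0 : A != 0 by rewrite -size_poly_gt0 (leq_trans sP).
pose c := lead_coef A; pose k := (size A - size P)%N.
have c0 : c != 0 by rewrite lead_coef_eq0.
have cK : c \in K by apply: (polyOverP AK).
pose Q := c *: 'X^k : {poly Om}.
have QK : Q \is a polyOver K by rewrite polyOverZ // rpredX // polyOverX.
have sQP : size (Q * P) = size A.
  rewrite size_Mmonic ?scaler_eq0 ?negb_or ?c0 ?monic_neq0 ?monicXn //.
  by rewrite size_scale // size_polyXn addSn /= subnK.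
have lt : (size (A - Q * P)%R < size A)%N.
  have : (size (A - Q * P)%R <= (size A).-1)%N.
    apply/leq_sizeP => j hj; rewrite coefB.
    have [->|ne] := eqVneq j (size A).-1.
      rewrite -[X in _ - _`_X.-1]sQP -!/(lead_coef _).
      by rewrite lead_coef_Mmonic // lead_coefZ lead_coefXn mulr1 subrr.
    have sj : (size A <= j)%N by lia.
    by rewrite !nth_default ?subrr ?sQP.
  have : (0 < size A)%N by rewrite size_poly_gt0.
  lia.
have [B [C [BK CK E sC]]] := IH _ (leq_trans lt sA) (rpredB AK (rpredM QK PK)).
exists (Q + B), C; split => //; first exact: rpredD.
by rewrite mulrDl -addrA -E subrKC.
Qed.

Definition min_poly_over x P : Prop :=
  [/\ P \is monic, P \is a polyOver K, root P x &
      forall A, A \is a polyOver K -> (size A < size P)%N -> root A x -> A = 0].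

Lemma min_poly_over_exists x n : (0 < n)%N -> x ^+ n = 1 -> exists P, min_poly_over x P.
Proof.
move=> n0 xn.
pose S k := `[< exists A, [/\ A != 0, A \is a polyOver K, root A x & size A = k] >].
have exS : exists k, S k.
  exists (size ('X^n - 1 : {poly Om})); apply/asboolP; exists ('X^n - 1); split => //.
  - by rewrite -size_poly_gt0 size_XnsubC.
  - by rewrite rpredB ?rpred1 // rpredX // polyOverX.
  - by rewrite /root !hornerE xn subrr.
case: (ex_minnP exS) => k /asboolP[A [A0 AK Ax <-]] hmin.
have l0 : lead_coef A != 0 by rewrite lead_coef_eq0.
have lK : (lead_coef A)^-1 \in K by rewrite rpredV; apply: (polyOverP AK).
exists ((lead_coef A)^-1 *: A); split.
- by rewrite monicE lead_coefZ mulVf.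
- by rewrite polyOverZ.
- by rewrite rootZ // invr_eq0.
move=> B BK; rewrite size_scale ?invr_eq0 // => sB Bx; apply: contraTeq sB => B0.
by rewrite -leqNgt; apply: hmin; apply/asboolP; exists B.
Qed.

Hypothesis K_complete : forall u, (forall n, u n \in K) -> cauchy v u ->
  exists2 l, l \in K & cvg_to v u l.

Lemma inv_nat_lt (e : R) : 0 < e -> exists N : nat, forall n, (N <= n)%N -> n.+1%:R^-1 < e.
Proof.
move=> e0; exists (Num.bound e^-1) => n hn.
rewrite invf_plt ?posrE ?ltr0Sn //; apply: lt_le_trans (archi_boundP _) _.
  by rewrite invr_ge0 ltW.
by rewrite ler_nat; exact: leqW.
Qed.

(** Otherwise polynomials B_n over K of degree below k satisfy B_n(x) -> x^k. The coordinate bound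
    makes their coefficients Cauchy, completeness of K gives limits in K, and these express x^k
    through lower powers, against independence. *)
Lemma power_separated x k (C : R) : v x = 1 -> 0 < C ->
  (forall A, A \is a polyOver K -> (size A <= k.+1)%N -> root A x -> A = 0) ->
  (forall A, A \is a polyOver K -> (size A <= k)%N -> forall i, v A`_i <= C * v A.[x]) ->
  exists2 d, 0 < d & forall A, A \is a polyOver K -> (size A <= k)%N -> d <= v (x ^+ k - A.[x]).
Proof.
move=> vx C0 indep IH; apply: contrapT => hd.
have /choice[B hB] : forall n : nat, exists B, [/\ B \is a polyOver K, (size B <= k)%N &
    v (x ^+ k - B.[x]) < n.+1%:R^-1].
  move=> n; apply: contrapT => hn; apply: hd; exists n.+1%:R^-1.
    by rewrite invr_gt0 ltr0Sn.
  move=> A AK sA; rewrite leNgt; apply/negP => h; apply: hn; by exists A.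
have BK n : B n \is a polyOver K by case: (hB n).
have sB n : (size (B n) <= k)%N by case: (hB n).
have vB n : v (x ^+ k - (B n).[x]) < n.+1%:R^-1 by case: (hB n).
have /choice[b hb] : forall i : nat, exists l, l \in K /\ cvg_to v (fun n => (B n)`_i) l.
  move=> i; suff [l lK hl] : exists2 l, l \in K & cvg_to v (fun n => (B n)`_i) l by exists l.
  apply: K_complete => [n|e e0]; first by apply: (polyOverP (BK n)).
  have [N hN] := inv_nat_lt (divr_gt0 e0 C0); exists N => m n hm hn.
  rewrite -coefB; apply: le_lt_trans (IH _ _ _ i) _; first exact: rpredB.
    by rewrite (leq_trans (size_polyD _ _)) // size_polyN geq_max !sB.
  rewrite mulrC -ltr_pdivlMr // !hornerE.
  apply: (v_dist_lt Hv (y := x ^+ k)).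
    by rewrite vC //; apply: lt_trans (vB m) (hN m hm).
  exact: lt_trans (vB n) (hN n hn).
pose P := \poly_(i < k) b i.
have PK : P \is a polyOver K.
  by apply/polyOverP => i; rewrite coef_poly; case: ifP; rewrite ?rpred0 //; case: (hb i).
have sP : (size P <= k)%N by exact: size_poly.
have E : x ^+ k - P.[x] = 0.
  apply: (v_eps0 Hv) => e e0.
  have [N0 hN0] := inv_nat_lt e0.
  have /choice[N hN] : forall i, exists N, forall n, (N <= n)%N -> v ((B n)`_i - b i) < e.
    by move=> i; case: (hb i) => _ /(_ e e0).
  pose n := maxn N0 (\max_(i < k) N i).
  apply: (v_dist_le Hv (y := (B n).[x])).
    by apply/ltW/(lt_trans (vB n))/hN0; rewrite leq_maxl.
  rewrite (horner_coef_wide _ (sB n)) (horner_coef_wide _ sP) -sumrB.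
  apply: v_sum_le => //; first exact: ltW.
  move=> i _; rewrite -mulrBl vM // vX // vx expr1n mulr1 coef_poly ltn_ord.
  apply/ltW/hN; rewrite leq_max; apply/orP; right.
  exact: (leq_bigmax_cond (F := fun i : 'I_k => N i) i).
have : 'X^k - P = 0.
  apply: indep; last by rewrite /root !hornerE E.
    by rewrite rpredB // rpredX // polyOverX.
  by rewrite (leq_trans (size_polyD _ _)) // size_polyN size_polyXn geq_max leqnn leqW.
move/(congr1 (fun A : {poly Om} => A`_k)); rewrite coefB coefXn eqxx coef0.
by rewrite [P`_k]nth_default // subr0 => /eqP; rewrite oner_eq0.
Qed.

(** Equivalence of norms on the K-span of 1, x, ..., x^(k-1), by induction on k: dividing A(x) by
    its top coordinate gives x^k minus an element of the smaller span, which stays at distance at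
    least d from 0. *)
Lemma coord_bound x k : v x = 1 ->
  (forall A, A \is a polyOver K -> (size A <= k)%N -> root A x -> A = 0) ->
  exists2 C : R, 0 < C &
    forall A, A \is a polyOver K -> (size A <= k)%N -> forall i, v A`_i <= C * v A.[x].
Proof.
move=> vx; elim: k => [|k IHk] indep.
  exists 1 => // A _; rewrite leqn0 size_poly_eq0 => /eqP-> i.
  by rewrite coef0 horner0 v0 // mulr0.
have [C C0 hC] : exists2 C : R, 0 < C & forall A, A \is a polyOver K ->
    (size A <= k)%N -> forall i, v A`_i <= C * v A.[x].
  by apply: IHk => A AK sA; apply: indep => //; exact: leqW.
have [d d0 hd] := power_separated vx C0 indep hC.
exists ((C + 1) * (1 + d^-1)); first by rewrite mulr_gt0 ?addr_gt0 ?invr_gt0.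
move=> A AK sA.
pose A' := \poly_(i < k) A`_i.
have A'K : A' \is a polyOver K.
  by apply/polyOverP => i; rewrite coef_poly; case: ifP; rewrite ?rpred0 // (polyOverP AK).
have sA' : (size A' <= k)%N by exact: size_poly.
have EA : A.[x] = A'.[x] + A`_k * x ^+ k.
  by rewrite (horner_coef_wide _ sA) big_ord_recr horner_poly.
have hk : v A`_k <= d^-1 * v A.[x].
  rewrite ler_pdivlMl //.
  have [->|a0] := eqVneq A`_k 0; first by rewrite v0 // mulr0 v_ge0.
  have -> : A.[x] = A`_k * (x ^+ k - (- (A`_k)^-1 *: A').[x]).
    by rewrite hornerZ EA mulrBr mulNr mulrN opprK mulrA divff // mul1r addrC.
  rewrite vM // mulrC ler_wpM2l ?v_ge0 // hd //.
    by rewrite polyOverZ // rpredN rpredV (polyOverP AK).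
  by rewrite (leq_trans (size_scale_leq _ _)).
have d1 : 0 <= d^-1 by rewrite invr_ge0 ltW.
have vA0 : 0 <= v A.[x] by exact: v_ge0.
have hx : v A'.[x] <= (1 + d^-1) * v A.[x].
  have -> : A'.[x] = A.[x] - A`_k * x ^+ k by rewrite EA addrK.
  apply: vB_le => //; first by rewrite mulrDl mul1r lerDl mulr_ge0.
  by rewrite vM // vX // vx expr1n mulr1 (le_trans hk) // mulrDl mul1r lerDr.
move=> i; have [ik|ki] := ltnP i k.
  have := hC A' A'K sA' i; rewrite coef_poly ik => h; apply: (le_trans h).
  rewrite -mulrA; apply: ler_pM => //; [exact: ltW | exact: v_ge0 | by rewrite lerDl].
have [->|ne] := eqVneq i k.
  apply: le_trans hk _; apply: ler_wpM2r => //.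
  have : 0 <= C * (1 + d^-1) by rewrite mulr_ge0 ?addr_ge0 // ltW.
  nra.
have si : (size A <= i)%N by apply: (leq_trans sA); rewrite ltn_neqAle eq_sym ne.
by rewrite nth_default // v0 // !mulr_ge0 ?addr_ge0 // ltW.
Qed.

(** Continuity of the conjugation A(x) -> A(y). Reducing A modulo the minimal polynomial of x
    changes neither value, and the coefficients of the remainder are controlled by |A(x)|. *)
Lemma conj_bound x y n : (0 < n)%N -> x ^+ n = 1 -> conj_over x y -> v y <= 1 ->
  exists2 C : R, 0 < C & forall A, A \is a polyOver K -> v A.[y] <= C * v A.[x].
Proof.
move=> n0 xn xy vy; have [P [Pm PK Px Pmin]] := min_poly_over_exists n0 xn.
have sP : (0 < size P)%N by rewrite size_poly_gt0 monic_neq0.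
have [|C C0 hC] := @coord_bound x (size P).-1 (v_unity Hv n0 xn).
  by move=> A AK sA; apply: Pmin => //; rewrite (leq_ltn_trans sA) // prednK.
exists C => // A AK; have [B [D [BK DK EA sD]]] := polyOver_mod_monic Pm PK AK.
rewrite EA !hornerE (rootP Px) (rootP (xy _ PK Px)) !mulr0 !add0r.
apply: v_horner_le => //; first by rewrite mulr_ge0 ?v_ge0 // ltW.
by move=> i; apply: hC => //; rewrite -ltnS prednK.
Qed.

Lemma exprz_root_of_unity x n i (k : int) : (0 < n)%N -> x ^+ n = 1 ->
  (x ^+ i) ^ k = x ^+ absz ((k * i%:Z) %% n%:Z)%Z.
Proof.
move=> n0 xn; have x0 : x != 0 by rewrite -(v_gt0 Hv) (v_unity Hv n0 xn) ltr01.
have nz : n%:Z != 0 by rewrite eqz_nat -lt0n.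
rewrite [x ^+ i]exprnP [x ^+ absz _]exprnP gez0_abs ?modz_ge0 // exprz_exp mulrC.
rewrite {1}(divz_eq (k * i%:Z) n%:Z) expfzDr // [_ * n%:Z]mulrC -exprz_exp.
by rewrite -exprnP xn exp1rz mul1r.
Qed.

Lemma conj_over_unity x y n : x ^+ n = 1 -> conj_over x y -> y ^+ n = 1.
Proof.
move=> xn xy; have /xy : ('X^n - 1 : {poly Om}) \is a polyOver K.
  by rewrite rpredB ?rpred1 // rpredX // polyOverX.
by rewrite /root !hornerE xn subrr eqxx => /(_ isT); rewrite subr_eq0 => /eqP.
Qed.

(** With exponents reduced modulo n, the partial sums become polynomials over K in x; the error x^j
    - A_N(x) is then carried to y by the bounded conjugation. *)
Lemma conj_eval (f : int -> Om) x y n i j : (forall n, f n \in K) ->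
  (0 < n)%N -> x ^+ n = 1 -> conj_over x y ->
  eval_to v f (x ^+ i) (x ^+ j) -> eval_to v f (y ^+ i) (y ^+ j).
Proof.
move=> fK n0 xn xy hf; have yn := conj_over_unity xn xy.
have [|C C0 hC] := conj_bound n0 xn xy; first by rewrite (v_unity Hv n0 yn).
pose A N := \sum_(k < N.*2.+1) f (k%:Z - N%:Z) *:
  'X^(absz (((k%:Z - N%:Z) * i%:Z) %% n%:Z)%Z) : {poly Om}.
have AE z N : z ^+ n = 1 -> partial_sum f (z ^+ i) N = (A N).[z].
  move=> zn; rewrite horner_sum; apply: eq_bigr => k _.
  by rewrite !hornerE (exprz_root_of_unity _ _ n0 zn).
have AK N : A N \is a polyOver K.
  by apply: rpred_sum => k _; rewrite polyOverZ // rpredX // polyOverX.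
move=> e e0; have [N hN] := hf (e / C) (divr_gt0 e0 C0); exists N => m hm.
have := hN m hm; rewrite ltr_pdivlMr // !AE // => h; apply: le_lt_trans h.
have := hC (A m - 'X^j); rewrite !hornerE [C * _]mulrC; apply.
by rewrite rpredB // rpredX // polyOverX.
Qed.

Section PrimitiveRoot.
Variables (n : nat) (t : Om).
Hypothesis t_prim : n.-primitive_root t.
Let n0 : (0 < n)%N := prim_order_gt0 t_prim.
Let tn : t ^+ n = 1 := prim_expr_order t_prim.

Lemma min_poly_over_split P : min_poly_over t P ->
  exists l : seq nat, [/\ uniq [seq t ^+ a | a <- l],
    forall a, a \in l -> conj_over t (t ^+ a) & P = \prod_(a <- l) ('X - (t ^+ a)%:P)].
Proof.
case=> Pm PK Px Pmin.
have Pdvd A : A \is a polyOver K -> root A t -> P %| A.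
  move=> AK At; have [B [C [BK CK EA sC]]] := polyOver_mod_monic Pm PK AK.
  have C0 : C = 0.
    apply: Pmin => //; move/rootP: At; rewrite EA !hornerE (rootP Px) mulr0 add0r.
    by move/eqP.
  by rewrite EA C0 addr0 dvdp_mull.
have : P %| 'X^n - 1.
  apply: Pdvd; first by rewrite rpredB ?rpred1 // rpredX // polyOverX.
  by rewrite /root !hornerE tn subrr.
rewrite -(factor_Xn_sub_1 t_prim) => /dvdp_prod_XsubC[m]; set l := mask _ _ => hP.
have EP : P = \prod_(a <- l) ('X - (t ^+ a)%:P).
  by apply/eqP; rewrite -eqp_monic // monic_prod_XsubC.
exists l; split=> //.
  rewrite map_inj_in_uniq ?mask_uniq ?iota_uniq // => a b al bl /eqP.
  rewrite (eq_prim_root_expr t_prim).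
  move: (mem_mask al) (mem_mask bl); rewrite !mem_index_iota /= => an bn.
  by rewrite !modn_small // => /eqP.
move=> a al A AK At; apply: (root_dvdp (Pdvd A AK At)).
by rewrite EP -(big_map (fun a => t ^+ a) predT (fun x => 'X - x%:P)) root_prod_XsubC map_f.
Qed.

(** Galois descent. Let C be the remainder of A modulo the minimal polynomial of t. Then C - A(t)
    vanishes at all conjugates of t, which are more numerous than its degree, so A(t) is the
    constant coefficient of C. *)
Lemma conj_fixed A : A \is a polyOver K ->
  (forall a, conj_over t (t ^+ a) -> A.[t ^+ a] = A.[t]) -> A.[t] \in K.
Proof.
move=> AK hA; have [P hP] := min_poly_over_exists n0 tn.
have [l [ul hl EP]] := min_poly_over_split hP; case: hP => [Pm PK Px _].
have [B [C [BK CK EA sC]]] := polyOver_mod_monic Pm PK AK.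
have sP : size P = (size l).+1 by rewrite EP size_prod_XsubC.
have AC y : root P y -> A.[y] = C.[y] by move/rootP=> Py; rewrite EA !hornerE Py mulr0 add0r.
have : C - (A.[t])%:P == 0.
  apply: contraT => h.
  have := @max_poly_roots _ (C - (A.[t])%:P) [seq t ^+ a | a <- l] h.
  rewrite ul size_map => /(_ _ isT) h'.
  have {h'} : (size l < size (C - (A.[t])%:P)%R)%N.
    apply: h'; apply/allP => _ /mapP[a al ->]; rewrite /root !hornerE -AC ?hA ?subrr //.
      exact: hl.
    exact: (hl a al P PK Px).
  rewrite ltnNge; case/negP; apply: leq_trans (size_polyD _ _) _.
  rewrite size_polyN geq_max -ltnS -sP sC /=; apply: leq_trans (size_polyC_leq1 _) _.
  rewrite lt0n; apply: contraTneq Px => /size0nil l0.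
  by rewrite EP l0 big_nil root1.
by rewrite subr_eq0 => /eqP E; have := polyOverP CK 0; rewrite E coefC.
Qed.

Lemma conj_overM a b : conj_over t (t ^+ a) -> conj_over t (t ^+ b) ->
  conj_over t (t ^+ (a * b)).
Proof.
move=> ha hb A AK At.
have BK : A \Po 'X^a \is a polyOver K.
  by rewrite polyOver_comp // rpredX // polyOverX.
have := hb _ BK; rewrite /root !horner_comp !hornerE -exprM mulnC; apply.
exact: (ha A AK At).
Qed.

Lemma conj_overX a k : conj_over t (t ^+ a) -> conj_over t (t ^+ (a ^ k)).
Proof.
move=> ha; elim: k => [|k IH]; first by rewrite expn0 expr1.
by rewrite expnS; exact: conj_overM.
Qed.

(** The minimal polynomial Q of t^a divides the minimal polynomial P = BQ of t; by minimality t is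
    not a root of B, so it is a root of Q. *)
Lemma conj_over_sym a : conj_over t (t ^+ a) -> conj_over (t ^+ a) t.
Proof.
move=> ha; have [P [Pm PK Px Pmin]] := min_poly_over_exists n0 tn.
have tan : (t ^+ a) ^+ n = 1 by rewrite exprAC tn expr1n.
have [Q [Qm QK Qx Qmin]] := min_poly_over_exists n0 tan.
have Qdvd A : A \is a polyOver K -> root A (t ^+ a) ->
    exists2 B, B \is a polyOver K & A = B * Q.
  move=> AK At; have [B [C [BK CK EA sC]]] := polyOver_mod_monic Qm QK AK.
  exists B => //; rewrite EA [C]Qmin ?addr0 //.
  by move: At; rewrite EA /root !hornerE (rootP Qx) mulr0 add0r.
have [B BK EP] := Qdvd P PK (ha P PK Px).
have Qt : root Q t.
  have := Px; rewrite EP rootM => /orP[Bt|//].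
  have P0 : P != 0 by exact: monic_neq0.
  have B0 : B != 0 by apply: contraNneq P0 => B0; rewrite EP B0 mul0r.
  have Q0 := monic_neq0 Qm.
  have : (size P <= size B)%N.
    by rewrite leqNgt; apply: contra B0 => sB; apply/eqP/Pmin.
  rewrite EP size_mul // => sz.
  have sB : (0 < size B)%N by rewrite size_poly_gt0.
  have sQ : (1 < size Q)%N by apply: root_size_gt1 Qx.
  by move: sz; rewrite -ltnS prednK ?addn_gt0 ?sB // -addn1 leq_add2l leqNgt sQ.
by move=> A AK /(Qdvd A AK)[D _ ->]; rewrite rootM Qt orbT.
Qed.

(** As t is in turn a conjugate of t^a, its order n divides the order n / gcd(a, n) of t^a. *)
Lemma conj_over_coprime a : conj_over t (t ^+ a) -> coprime a n.
Proof.
move=> /conj_over_sym ha.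
have g0 : (0 < gcdn a n)%N by rewrite gcdn_gt0 n0 orbT.
have := conj_over_unity (prim_expr_order (exp_prim_root t_prim a)) ha.
move/eqP; rewrite -(prim_order_dvd t_prim) => h.
rewrite /coprime eqn_leq g0 andbT.
have := dvdn_leq _ h; rewrite divn_gt0 // dvdn_leq ?dvdn_gcdr // => /(_ isT).
by rewrite leq_divRL // -[leqRHS]muln1 leq_pmul2l.
Qed.

Lemma conj_over_inv a : conj_over t (t ^+ a) ->
  exists2 b, conj_over t (t ^+ b) & (a * b = 1 %[mod n])%N.
Proof.
move=> ha; exists (a ^ (totient n).-1)%N; first exact: conj_overX.
rewrite -expnS prednK ?totient_gt0 //; apply: Euler_exp_totient.
exact: conj_over_coprime.
Qed.

End PrimitiveRoot.
End Conjugates.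

(** * Galois groups of cyclotomic extensions *)

Lemma modn_dvd_eq d n a b : (d %| n)%N -> (a = b %[mod n])%N -> (a = b %[mod d])%N.
Proof. by move=> dn h; rewrite -(modn_dvdm a dn) h modn_dvdm. Qed.

Lemma chinese_eq m n a b : coprime m n -> (a = b %[mod m])%N -> (a = b %[mod n])%N ->
  (a = b %[mod m * n])%N.
Proof.
by move=> mn h1 h2; apply/eqP; rewrite chinese_remainder // h1 h2 !eqxx.
Qed.

Lemma eq_mod_mul d a b a' b' : (a = a' %[mod d])%N -> (b = b' %[mod d])%N ->
  (a * b = a' * b' %[mod d])%N.
Proof. by move=> h1 h2; rewrite -modnMml -modnMmr h1 h2 modnMml modnMmr. Qed.

Lemma eq_mod_exp1 d a k : (a = 1 %[mod d])%N -> (a ^ k = 1 %[mod d])%N.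
Proof. by move=> h; rewrite -modnXm h modnXm exp1n. Qed.

Lemma coprime_mulIn a n i j : coprime a n -> (a * i = a * j %[mod n])%N -> (i = j %[mod n])%N.
Proof.
move=> an; wlog ji : i j / (j <= i)%N.
  move=> h; case/orP: (leq_total i j) => ij e; last exact: h.
  by apply/esym/h.
move=> /eqP; rewrite eqn_mod_dvd ?leq_mul2l ?ji ?orbT // -mulnBr.
by rewrite Gauss_dvdr 1?coprime_sym // -eqn_mod_dvd // => /eqP.
Qed.

(** Here c is the p-adic valuation of a - 1. *)
Lemma eq1_mod_depth p r C a : prime p -> (0 < r)%N -> coprime p r ->
  (a = 1 %[mod r * p ^ 2])%N -> (a != 1 %[mod p ^ C])%N ->
  exists c u, [/\ (2 <= c < C)%N, coprime p u & a = (1 + p ^ c * (r * u))%N].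
Proof.
move=> pP r0 pr h1 h2.
have rp2 : (1 < r * p ^ 2)%N.
  by apply: leq_trans (leq_pmull _ r0); rewrite (ltn_exp2l 0) // prime_gt1.
have a0 : (0 < a)%N by case: a h1 {h2} => // /eqP; rewrite mod0n modn_small.
have d1 : (r * p ^ 2 %| a - 1)%N by rewrite -eqn_mod_dvd //; apply/eqP.
have d2 : ~~ (p ^ C %| a - 1)%N by rewrite -eqn_mod_dvd.
have a1 : (0 < a - 1)%N by rewrite lt0n; apply: contraNneq d2 => ->.
have dr : (r %| a - 1)%N by apply: dvdn_trans d1; rewrite dvdn_mulr.
have dp : (p ^ 2 %| a - 1)%N by apply: dvdn_trans d1; rewrite dvdn_mull.
have [m pm am] := pfactor_coprime pP a1; set c := logn p (a - 1) in am.
have rm : (r %| m)%N.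
  by move: dr; rewrite am Gauss_dvdl // coprimeXr // coprime_sym.
have /dvdnP[u mu] := rm.
exists c, u; split.
- by rewrite /c -!pfactor_dvdn // dp ltnNge -pfactor_dvdn.
- by move: pm; rewrite mu coprimeMr => /andP[].
- by rewrite -[in LHS](subnKC a0) am mu; lia.
Qed.

Section UnitMul.
Variables (n a : nat).
Hypotheses (n0 : (0 < n)%N) (an : coprime a n).
Definition ord_mulmod (i : 'I_n) : 'I_n := Ordinal (ltn_pmod (a * i) n0).
Lemma ord_mulmod_inj : injective ord_mulmod.
Proof.
move=> i j /(congr1 val) /= /(coprime_mulIn an).
by rewrite !modn_small ?ltn_ord // => /val_inj.
Qed.
End UnitMul.

Section GaloisArithmetic.
Variables (Om : closedFieldType) (K : divringClosed Om) (p n s r : nat) (t : Om).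
Hypotheses (pP : prime p) (t_prim : n.-primitive_root t).
Hypotheses (nE : n = (p ^ s * r)%N) (pr : coprime p r).

Let p0 : (0 < p)%N := prime_gt0 pP.
Let n0 : (0 < n)%N := prim_order_gt0 t_prim.
Let r0 : (0 < r)%N.
Proof. by move: n0; rewrite nE muln_gt0 => /andP[]. Qed.
Let tn : t ^+ n = 1 := prim_expr_order t_prim.
Notation galois a := (conj_over K t (t ^+ a)).

Lemma conj_over1 : galois 1.
Proof. by move=> A _; rewrite expr1. Qed.

Lemma tame_part_eq a b : (t ^+ (p ^ s)) ^+ a = (t ^+ (p ^ s)) ^+ b -> (a = b %[mod r])%N.
Proof.
rewrite -!exprM => /eqP; rewrite (eq_prim_root_expr t_prim) nE -!muln_modr eqn_pmul2l ?expn_gt0 ?p0 //.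
by move/eqP.
Qed.

(** For N dividing n, the image of the Galois group of K(t) over K in the units modulo N. *)
Definition residues N (i : nat) : bool := `[< exists2 a, galois a & (a %% N)%N = i >].

Lemma residues_mul N a i : (N %| n)%N -> galois a -> (i < N)%N ->
  residues N (a * i %% N) = residues N i.
Proof.
move=> Nn ha iN; apply/asboolP/asboolP => -[b hb bi].
  have [c hc ac] := conj_over_inv t_prim ha.
  exists (c * b)%N; first exact: conj_overM.
  rewrite -modnMmr bi modnMmr mulnA (mulnC c) -modnMml (modn_dvd_eq Nn ac).
  by rewrite modnMml mul1n modn_small.
exists (a * b)%N; first exact: conj_overM.
by rewrite -modnMmr bi.
Qed.

(** With W = r p^C, z of order p^C and w of order r, the inner product for i = 1 is the relative
    norm of z - 1 from K(mu_W) to K(mu_r), and the other i give its conjugates. The sum is thus the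
    trace to K of this norm times w^k. *)
Definition norm_moment (W k : nat) (z w : Om) : Om :=
  \sum_(i < r | residues r i)
    (\prod_(b < W | residues W b && (b %% r == i)%N) (z ^+ b - 1)) * (w ^+ i) ^+ k.

Lemma norm_moment_conj W k z w a : (r %| W)%N -> (W %| n)%N -> galois a ->
  z ^+ W = 1 -> w ^+ r = 1 -> norm_moment W k (z ^+ a) (w ^+ a) = norm_moment W k z w.
Proof.
move=> rW Wn ha zW wr; have W0 : (0 < W)%N := dvdn_gt0 n0 Wn.
have an := conj_over_coprime t_prim ha.
have aW : coprime a W := coprime_dvdr Wn an.
have ar : coprime a r := coprime_dvdr rW aW.
have rn := dvdn_trans rW Wn.
rewrite /norm_moment [RHS](reindex_inj (@ord_mulmod_inj r a r0 ar)).
apply: eq_big => [i|i _] /=; first by rewrite residues_mul.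
congr (_ * _); last by rewrite (expr_mod _ wr) exprM.
rewrite [RHS](reindex_inj (@ord_mulmod_inj W a W0 aW)).
apply: eq_big => [b|b _] /=; last by rewrite (expr_mod _ zW) exprM.
rewrite residues_mul //; congr (_ && _); rewrite modn_dvdm //.
apply/eqP/eqP => [<-|/(coprime_mulIn ar)]; first by rewrite modnMmr.
by rewrite [(i %% r)%N]modn_small ?ltn_ord.
Qed.

(** The p-th power of 1 + x with x = p^(c+k) r u' is 1 + p x plus a multiple of x^2. Since c >= 2,
    that multiple is divisible by p^(c+k+2), so the depth rises by exactly one. *)
Lemma galois_tower c u : (2 <= c)%N -> coprime p u -> galois (1 + p ^ c * (r * u)) ->
  forall k, exists2 u', coprime p u' & galois (1 + p ^ (c + k) * (r * u')).
Proof.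
move=> c2 pu gu; elim=> [|k [u' pu' gu']]; first by exists u; rewrite ?addn0.
pose x := (p ^ (c + k) * (r * u'))%N.
have [y hy] : exists y, ((1 + x) ^ p = 1 + p * x + x ^ 2 * y)%N.
  elim: (p) => [|q [y IH]]; first by exists 0%N; rewrite expn0; lia.
  exists (y + x * y + q)%N; rewrite expnS IH; ring.
exists (u' + p * (p ^ (c + k - 2) * (r * u' ^ 2 * y)))%N.
  by rewrite /coprime addnC [(p * _)%N]mulnC gcdnMDl.
rewrite (_ : (1 + _)%N = (1 + x) ^ p)%N; first exact: conj_overX.
have qE : (p ^ (c + k) = p ^ (c + k - 2) * p ^ 2)%N by rewrite -expnD subnK //; lia.
rewrite hy /x addnS expnS; move: qE; set q := (p ^ (c + k))%N; set q' := (p ^ _)%N => qE.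
have -> : ((q * (r * u')) ^ 2 * y = q * (q' * p ^ 2) * (r * u') ^ 2 * y)%N by rewrite -qE; ring.
ring.
Qed.

Lemma galois_lift c u k b : (0 < s)%N -> (2 <= c)%N -> coprime p u ->
  galois (1 + p ^ c * (r * u)) -> (b = 1 %[mod r * p ^ c])%N ->
  exists2 h, galois h & (h = b %[mod r * p ^ (c + k)])%N.
Proof.
move=> s0 c2 pu gu hb; elim: k => [|k [h gh hhb]].
  by exists 1%N; [exact: conj_over1 | rewrite addn0].
have [w pw gw] := galois_tower c2 pu gu k.
pose N := (r * p ^ (c + k))%N.
have N0 : (0 < N)%N by rewrite muln_gt0 r0 expn_gt0 p0.
have E' : (r * p ^ (c + k.+1) = N * p)%N by rewrite addnS expnSr mulnA.
(* Same class as b modulo N p, but at least h, so that the natural subtraction b' - h is exact. *)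
pose b' := (b + h * (N * p))%N.
have hb' : (h <= b')%N.
  by rewrite /b' (leq_trans _ (leq_addl _ _)) // leq_pmulr // muln_gt0 N0.
have /dvdnP[d hd] : (N %| b' - h)%N.
  rewrite -eqn_mod_dvd //; apply/eqP; rewrite /b'.
  by rewrite (_ : h * (N * p) = h * p * N)%N ?modnMDr 1?addnC ?modnMDl ?hhb //; ring.
have cop : coprime (h * w) p.
  rewrite coprimeMl [coprime w p]coprime_sym pw andbT.
  by apply: coprime_dvdr (conj_over_coprime t_prim gh); rewrite nE dvdn_mulr // dvdn_exp.
(* Modulo N p the factor (1 + N w)^j is 1 + j N w, because p divides N; it changes h by N h w j,
   which has to match d N. *)
have [j hj] : exists j, (h * w * j = d %[mod p])%N.
  exists ((h * w) ^ (totient p).-1 * d)%N.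
  rewrite mulnA -expnS prednK ?totient_gt0 // -modnMml Euler_exp_totient //.
  by rewrite modnMml mul1n.
exists (h * (1 + p ^ (c + k) * (r * w)) ^ j)%N.
  by apply: conj_overM => //; exact: conj_overX.
have [y hy] : exists y, ((1 + N * w) ^ j = 1 + j * (N * w) + (N * w) ^ 2 * y)%N.
  elim: (j) => [|q [y IH]]; first by exists 0%N; rewrite expn0; lia.
  exists (y + N * w * y + q)%N; rewrite expnS IH; ring.
rewrite (_ : p ^ (c + k) * (r * w) = N * w)%N; last by rewrite /N; ring.
rewrite E' hy.
have -> : (b = b' %[mod N * p])%N by rewrite /b' addnC modnMDl.
have -> : b' = (h + d * N)%N by rewrite -hd subnKC.
have /dvdnP[N' N'E] : (p %| N)%N by rewrite dvdn_mull // dvdn_exp // addn_gt0 (leq_trans _ c2).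
have -> : (h * (1 + j * (N * w) + (N * w) ^ 2 * y) =
   (h * w ^ 2 * y * N') * (N * p) + (h + N * (h * w * j)))%N.
  have -> : ((N * w) ^ 2 = N * (N' * p) * w ^ 2)%N by rewrite -N'E; ring.
  ring.
rewrite modnMDl; apply/eqP; rewrite eqn_modDl mulnC [(d * N)%N]mulnC.
by rewrite mulnC -!muln_modr hj.
Qed.

(** For s < C the hypothesis on b forces b = 1 modulo n. Otherwise a single Galois element of depth
    c < C reaches, by lifting up to depth s, every residue that is 1 modulo r p^c. *)
Lemma galois_large C : (2 <= C)%N ->
  ((C <= s)%N -> exists a, [/\ galois a, (a = 1 %[mod r * p ^ 2])%N & (a != 1 %[mod p ^ C])%N]) ->
  forall b, (b = 1 %[mod r * p ^ C])%N -> galois b.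
Proof.
move=> C2 hC b hb.
have red a a' : (a = a' %[mod n])%N -> galois a -> galois a'.
  by move=> e; rewrite -(expr_mod a tn) e (expr_mod _ tn).
have [sC|Cs] := ltnP s C.
  apply: red conj_over1; apply/esym; apply: modn_dvd_eq hb.
  by rewrite nE mulnC dvdn_mul // dvdn_exp2l // ltnW.
have [a [ga a1 a2]] := hC Cs.
have [c [u [/andP[c2 cC] pu aE]]] := eq1_mod_depth pP r0 pr a1 a2.
rewrite aE in ga.
have cs : (c <= s)%N by rewrite ltnW // (leq_trans cC).
have [|h gh hE] := galois_lift (s - c) (leq_trans (ltnW C2) Cs) c2 pu ga (b := b).
  by apply: modn_dvd_eq hb; rewrite dvdn_mul // dvdn_exp2l // ltnW.
by apply: red gh; rewrite nE mulnC -(subnKC cs).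
Qed.
End GaloisArithmetic.

(** * Ramification of roots of unity of p-power order *)

Section Ramification.
Variables (R : realType) (Om : closedFieldType) (v : Om -> R).
Hypothesis Hv : nonarch_abs v.
Variable K : divringClosed Om.
Variable p : nat.
Hypothesis pP : prime p.
Hypothesis vp : v p%:R < 1.

Let p0 : (0 < p)%N := prime_gt0 pP.

(** For order p, p is the sum of the 1 - z^i, all multiples of z - 1. For higher order it suffices
    that |z^p - 1| <= |z - 1|^p, and the induction hypothesis applies to z^p. *)
Lemma v_prim_root_near1 z C : 0 < v p%:R -> (p ^ C.+1).-primitive_root z ->
  v p%:R <= v (z - 1) ^+ (p ^ C).
Proof.
move=> vp0; elim: C z => [|C IH] z hz.
  rewrite expn0 expr1; rewrite expn1 in hz.
  have z1 : z - 1 != 0.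
    rewrite subr_eq0 -[z]expr1 -(prim_order_dvd hz) dvdn1.
    by rewrite gtn_eqF // prime_gt1.
  have s0 : \sum_(i < p) z ^+ i = 0.
    by apply: (mulfI z1); rewrite -subrX1 prim_expr_order // subrr mulr0.
  have -> : p%:R = \sum_(i < p) (1 - z ^+ i).
    by rewrite sumrB s0 subr0 sumr_const card_ord.
  apply: v_sum_le; rewrite ?v_ge0 // => i _; rewrite vC // subrX1 vM //.
  rewrite ler_piMr ?v_ge0 //; apply: v_sum_le => // j _.
  by rewrite vX_le1 // (v_unity Hv p0) // prim_expr_order.
have hzp : (p ^ C.+1).-primitive_root (z ^+ p).
  have := exp_prim_root hz p.
  by rewrite expnS (gcdn_idPl (dvdn_mulr _ (dvdnn p))) mulKn.
have h := IH _ hzp.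
have zn := prim_expr_order hz; have vz := v_unity_near1 Hv pP vp zn.
have hlow : v p%:R <= v (z ^+ p - 1).
  have zp1 : v (z ^+ p - 1) < 1 by apply: (v_unity_near1 Hv pP vp (prim_expr_order hzp)).
  apply: (le_trans h); rewrite -[leRHS]expr1; apply: ler_wiXn2l; rewrite ?v_ge0 ?(ltW zp1) //.
  by rewrite expn_gt0 p0.
suff hle : v (z ^+ p - 1) <= v (z - 1) ^+ p.
  apply: (le_trans h); rewrite [in leRHS]expnS exprM; apply: lerXn2r hle;
    by rewrite nnegrE ?exprn_ge0 ?v_ge0.
rewrite leNgt; apply/negP => hlt.
have v11 : v 1 <= 1 by rewrite v1.
have := v_powp_add Hv pP (ltW vz) v11.
rewrite subrK v1 // mulr1 expr1n => h2.
(* The second alternative would put |z^p - 1| strictly below |p|, against [hlow]. *)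
have : v (z ^+ p - 1) <= Num.max (v (z - 1) ^+ p) (v p%:R * v (z - 1)).
  have -> : z ^+ p - 1 = (z - 1) ^+ p + (z ^+ p - ((z - 1) ^+ p + 1)) by ring.
  by apply: vD_le => //; rewrite le_max ?h2 ?orbT // vX // lexx.
rewrite le_max leNgt hlt /= => h3; have := le_trans hlow h3.
by rewrite leNgt -[X in _ < X]mulr1 ltr_pM2l ?vz.
Qed.

Section Level.
Variables (n s r : nat) (t : Om).
Hypothesis t_prim : n.-primitive_root t.
Hypothesis nE : n = (p ^ s * r)%N.
Hypothesis pr : coprime p r.

Let n0 : (0 < n)%N := prim_order_gt0 t_prim.
Let r0 : (0 < r)%N.
Proof. by move: n0; rewrite nE muln_gt0 => /andP[]. Qed.
Let tn : t ^+ n = 1 := prim_expr_order t_prim.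
Notation galois a := (conj_over K t (t ^+ a)).

Lemma tame_part : tame_root v (t ^+ (p ^ s)).
Proof.
exists r; split; first by rewrite (v_nat_coprime Hv pP vp).
by rewrite -exprM -nE.
Qed.

(* An element of O_K is congruent to its q-th power, so the minimal polynomial of t
   almost vanishes at t^q, which must therefore be close to a conjugate of t. *)
Lemma frobenius_conj q m : q = (p ^ m)%N ->
  (forall c, c \in K -> v c <= 1 -> v (c ^+ q - c) < 1) ->
  exists2 a, galois a & (a = q %[mod r])%N.
Proof.
move=> qE hq; have vt := v_unity Hv n0 tn.
have [P hP] := min_poly_over_exists K n0 tn.
have [l [ul hl EP]] := min_poly_over_split t_prim hP; case: hP => [Pm PK Px _].
have q0 : (0 < q)%N by rewrite qE expn_gt0 p0.
have Pint i : v P`_i <= 1.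
  rewrite EP; elim: (l) i => [|a l' IH] i; first by rewrite big_nil coef1; case: (i == _); rewrite ?v0 ?v1.
  rewrite big_cons mulrC mulrBr coefB coefMC coefMX; apply: vB_le => //.
    by case: (i == _); rewrite ?v0.
  by rewrite vM // vX // vt expr1n mulr1.
have : v (P.[t ^+ q]) < 1.
  (* Modulo the maximal ideal the q-th power is additive and fixes the coefficients of P, so P(t)^q
     and P(t^q) agree. *)
  have : v (P.[t] ^+ q - P.[t ^+ q]) < 1.
    rewrite horner_coef (horner_coef _ (t ^+ q)).
    have hF (i : 'I_(size P)) : v (P`_i * t ^+ i) <= 1.
      by rewrite vM // vX // vt expr1n mulr1.
    have := v_powpX_sum Hv pP vp m hF; rewrite -qE => h.
    apply: (v_dist_lt Hv h); rewrite -sumrB; apply: v_sum_lt => // i _.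
    rewrite exprMn exprAC -mulrBl vM // !vX // vt !expr1n mulr1.
    by apply: hq => //; apply: (polyOverP PK).
  by rewrite (rootP Px) expr0n gtn_eqF // sub0r vN.
rewrite EP horner_prod => /(v_prod_lt1 Hv)[a al]; rewrite !hornerE => ha.
exists a; first exact: hl.
(* Raising t^q and t^a to the power p^s keeps them close and makes them tame, hence equal. *)
apply/esym/(tame_part_eq pP t_prim nE); apply: (tame_root_close Hv); rewrite ?tame_rootX //; try exact: tame_rootX tame_part.
rewrite -!exprM ![(p ^ s * _)%N]mulnC !exprM.
by rewrite (v_powpX_sub Hv pP vp) // vX_le1 // vt.
Qed.

(* If the Galois group over K(mu_r) were too small modulo p^C, the products y_i of the
   conjugates of z - 1 would have moments in K although |y_i| lies strictly between |pi| and 1. *)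
Lemma small_galois_bound C pi : (2 <= C <= s)%N ->
  (forall x, x \in K -> v x < 1 -> v x <= pi) ->
  (forall a, galois a -> (a = 1 %[mod r * p ^ 2])%N -> (a = 1 %[mod p ^ C])%N) ->
  v (t ^+ (p ^ (s - C) * r) - 1) ^+ (p ^ 2) <= pi.
Proof.
move=> /andP[C2 Cs] hpi hC; set z := t ^+ _; pose w := t ^+ (p ^ s).
pose W := (r * p ^ C)%N.
have ps : (p ^ s = p ^ (s - C) * p ^ C)%N by rewrite -expnD subnK.
have WE : (p ^ (s - C) * r * p ^ C = n)%N by rewrite nE ps; lia.
have Wn : (W %| n)%N by rewrite -WE -mulnA dvdn_mull.
have rW : (r %| W)%N by rewrite dvdn_mulr.
have rn := dvdn_trans rW Wn.
have zpC : z ^+ (p ^ C) = 1 by rewrite -exprM WE.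
have zW : z ^+ W = 1 by rewrite /W mulnC exprM zpC expr1n.
have wr : w ^+ r = 1 by rewrite -exprM -nE.
have vz1 := v_unity_near1 Hv pP vp zpC.
have W0 : (0 < W)%N := dvdn_gt0 n0 Wn.
pose y (i : 'I_r) := \prod_(b < W | residues K t W b && (b %% r == i)%N) (z ^+ b - 1).
have vzb b : v (z ^+ b - 1) < 1.
  by apply: (v_unity_near1 Hv pP vp (n := C)); rewrite exprAC zpC expr1n.
have vy (i : 'I_r) : residues K t r i -> v (y i) < 1.
  move=> /asboolP[a ha ai].
  (* A product of factors below 1 is below 1 as soon as it is nonempty; a Galois element above i
     supplies a factor. *)
  pose b := Ordinal (ltn_pmod a W0).
  have hb : residues K t W b && (b %% r == i)%N.
    by rewrite /= modn_dvdm // ai eqxx andbT; apply/asboolP; exists a.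
  rewrite /y (bigD1 b) //= vM //; apply: le_lt_trans (vzb (a %% W)%N).
  rewrite ler_piMr ?v_ge0 //; elim/big_ind: _ => [|x x' hx hx'|j _]; first by rewrite v1.
    by rewrite vM // mulr_ile1 ?v_ge0.
  exact: ltW.
have momK k : norm_moment K r t W k z w \in K.
  pose A : {poly Om} := \sum_(i < r | residues K t r i)
    (\prod_(b < W | residues K t W b && (b %% r == i)%N) ('X^(p ^ (s - C) * r * b) - 1))
      * 'X^(p ^ s * i * k).
  have AE x : A.[x] = norm_moment K r t W k (x ^+ (p ^ (s - C) * r)) (x ^+ (p ^ s)).
    rewrite horner_sum; apply: eq_bigr => i _; rewrite hornerM horner_prod.
    congr (_ * _); last by rewrite !hornerE !exprM.
    by apply: eq_bigr => b _; rewrite !hornerE exprM.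
  rewrite -AE; apply: (conj_fixed t_prim).
    apply: rpred_sum => i _; rewrite rpredM ?rpredX ?polyOverX //.
    by apply: rpred_prod => b _; rewrite rpredB ?rpred1 ?rpredX ?polyOverX.
  move=> a ha; rewrite !AE ![(t ^+ a) ^+ _]exprAC.
  exact: (norm_moment_conj t_prim nE).
have pi0 : 0 <= pi.
  by apply: le_trans (hpi 0 (rpred0 _) _); rewrite v0.
have mom k : v (norm_moment K r t W k z w) <= pi.
  apply: hpi => //; apply: v_sum_lt => // i hi; rewrite vM //.
  by rewrite [v (_ ^+ k)]vX // [v (w ^+ i)]vX // (v_unity Hv r0 wr) !expr1n mulr1 vy.
have yle (i : 'I_r) : residues K t r i -> v (y i) <= pi.
  move=> hi; pose l := [seq j <- enum 'I_r | residues K t r (j : 'I_r)].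
  have il : i \in l by rewrite mem_filter hi mem_enum.
  apply: (weights_le_of_moments Hv (s := l) (x := fun j : 'I_r => w ^+ j) (y := y)) il => //.
  - by rewrite filter_uniq ?enum_uniq.
  - by move=> j _; rewrite vX // (v_unity Hv r0 wr) expr1n.
  - move=> j j' _ _ jj'; apply: (tame_root_dist Hv); rewrite ?tame_rootX //; try exact: tame_rootX tame_part.
    apply: contraNneq jj' => /(tame_part_eq pP t_prim nE).
    by rewrite !modn_small // => /val_inj->.
  - move=> k; rewrite big_filter big_enum_cond /=; exact: mom.
pose i1 : 'I_r := Ordinal (ltn_pmod 1 r0).
have hi1 : residues K t r i1 by apply/asboolP; exists 1%N => //; exact: conj_over1.
apply: le_trans (yle i1 hi1); rewrite /y v_prod //.
set J := (X in \prod_(b < W | X b) _); pose J' := [pred b : 'I_W | J b].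
apply: le_trans (_ : v (z - 1) ^+ #|J'| <= _).
  apply: ler_wiXn2l; rewrite ?v_ge0 ?(ltW vz1) //.
  (* At most p^2 factors occur for i = 1: two indices congruent modulo p^2 come from Galois elements
     whose quotient is 1 modulo r p^2, hence 1 modulo p^C by [hC], so they coincide modulo W. *)
  have p20 : (0 < p ^ 2)%N by rewrite expn_gt0 p0.
  pose h (b : 'I_W) : 'I_(p ^ 2) := Ordinal (ltn_pmod b p20).
  have hinj : {in J' &, injective h}.
    move=> b b' /andP[/asboolP[a ha ab] /eqP br] /andP[/asboolP[a' ha' ab'] /eqP br'].
    move=> /(congr1 val) /= bb'; apply: val_inj => /=.
    have [c hc ac] := conj_over_inv t_prim ha.
    have p2W : (p ^ 2 %| W)%N by rewrite dvdn_mull // dvdn_exp2l.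
    have cpr : coprime r (p ^ 2) by rewrite coprimeXr // coprime_sym.
    have aa' : (a = a' %[mod r * p ^ 2])%N.
      apply: chinese_eq => //.
        by rewrite -(modn_dvdm a rW) -(modn_dvdm a' rW) ab ab' br br'.
      by rewrite -(modn_dvdm a p2W) -(modn_dvdm a' p2W) ab ab'.
    have rp2n : (r * p ^ 2 %| n)%N.
      by apply: dvdn_trans Wn; rewrite dvdn_mul // dvdn_exp2l.
    have hca : (a' * c = 1 %[mod p ^ C])%N.
      apply: hC; first exact: conj_overM.
      by rewrite -modnMml -aa' modnMml; exact: modn_dvd_eq ac.
    have pCn : (p ^ C %| n)%N by rewrite -WE dvdn_mull.
    have : (a' = a %[mod p ^ C])%N.
      have /(eq_mod_mul (erefl (a' %% p ^ C)%N)) := modn_dvd_eq pCn ac.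
      rewrite muln1 => <-; rewrite mulnCA -modnMmr hca modnMmr muln1 //.
    move=> aa2; rewrite -ab -ab'; apply: chinese_eq => //.
      by rewrite coprimeXr // coprime_sym.
    by rewrite -(modn_dvdm a rW) -(modn_dvdm a' rW) ab ab' br br'.
  rewrite -(card_in_imset hinj); apply: leq_trans (max_card _) _.
  by rewrite card_ord.
rewrite -prodr_const; apply: ler_prod => b /andP[/asboolP[a ha ab] _].
rewrite v_ge0 //=.
(* As z is a power of z^a, z - 1 is a multiple of z^a - 1 by an integral element. *)
have [c _ ac] := conj_over_inv t_prim ha.
have E : z = (z ^+ a) ^+ c.
  by rewrite -exprM -(expr_mod _ zW) (modn_dvd_eq Wn ac) (expr_mod _ zW) expr1.
rewrite -ab (expr_mod _ zW) {1}E subrX1 vM // ler_piMr ?v_ge0 //.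
apply: v_sum_le => // j _; rewrite vX_le1 // vX // (v_unity Hv (n := p ^ C)) ?expr1n //.
by rewrite expn_gt0 p0.
Qed.

End Level.
End Ramification.

(** * Characteristic zero *)

Section CharZero.
Variables (R : realType) (Om : closedFieldType) (v : Om -> R).
Hypothesis Hv : nonarch_abs v.
Hypothesis char0 : [pchar Om] =i pred0.
Variable K : divringClosed Om.
Variable p : nat.
Hypothesis pP : prime p.
Hypothesis vp : v p%:R < 1.
Implicit Types (f : int -> Om) (x y : Om).

Let p0 : (0 < p)%N := prime_gt0 pP.

Lemma char0_v_nat_gt0 n : (0 < n)%N -> 0 < v n%:R.
Proof. by move=> n0; rewrite v_gt0 // (pcharf0P _).1 // -lt0n. Qed.

Lemma prim_root_exists n : (0 < n)%N -> exists t : Om, n.-primitive_root t.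
Proof.
move=> n0; have [rs E] := closed_field_poly_normal ('X^n - 1 : {poly Om}).
have Em : 'X^n - 1 = \prod_(z <- rs) ('X - z%:P) :> {poly Om}.
  by rewrite [LHS]E (eqP (monicXnsubC 1 n0)) scale1r.
have sz : size rs = n.
  by apply/succn_inj; rewrite -(size_prod_XsubC rs (fun z => z)) -Em size_XnsubC.
have nR : n%:R != 0 :> Om by rewrite (pcharf0P _).1 // -lt0n.
have /(has_prim_root n0) h : all n.-unity_root rs.
  by apply/allP => z zr; rewrite /root_of_unity Em root_prod_XsubC.
have us : uniq rs by rewrite -separable_prod_XsubC -Em separable_Xn_sub_1.
by have /hasP[z _ hz] := h us (eq_leq (esym sz)); exists z.
Qed.

(** Here e is the ramification index of K. If no Galois element had depth between 2 and e + 3, a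
    root of unity z of order p^(e+3) would satisfy |z - 1|^(p^2 e) <= |p| <= |z - 1|^(p^(e+2)),
    which is impossible because e < p^e. *)
Lemma galois_uniform (pi : R) e : 0 < pi -> v p%:R = pi ^+ e ->
  (forall x, x \in K -> v x < 1 -> v x <= pi) ->
  forall C, (e + 3 <= C)%N -> forall n s r t, n.-primitive_root t -> n = (p ^ s * r)%N ->
  coprime p r -> forall b, (b = 1 %[mod r * p ^ C])%N -> conj_over K t (t ^+ b).
Proof.
move=> pi0 ve hpi C eC n s r t tp nE pr b hb.
have vp0 := char0_v_nat_gt0 p0.
have hb' : (b = 1 %[mod r * p ^ (e + 3)])%N.
  by apply: modn_dvd_eq hb; rewrite dvdn_mul // dvdn_exp2l.
apply: (galois_large pP tp nE pr (C := e + 3)) hb'; first by rewrite addnC.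
move=> Cs; apply: contrapT => hno.
have C2s : (2 <= e + 3 <= s)%N by rewrite Cs andbT; lia.
have := small_galois_bound Hv pP vp tp nE pr C2s hpi.
set z := t ^+ _ => hz.
have {}hz : v (z - 1) ^+ (p ^ 2) <= pi.
  apply: hz => a ga a1; apply/eqP; apply: contrapT => /negP a2; apply: hno.
  by exists a.
have zp : (p ^ (e + 2).+1).-primitive_root z.
  have E : n = (p ^ (s - (e + 3)) * r * p ^ (e + 3))%N by rewrite nE mulnAC -expnD subnK.
  have := dvdn_prim_root tp (_ : p ^ (e + 3) %| n)%N.
  by rewrite E mulnK ?expn_gt0 ?p0 // -addnS; apply; rewrite dvdn_mull.
have h1 := v_prim_root_near1 Hv pP vp vp0 zp.
have z1 : v (z - 1) < 1 := v_unity_near1 Hv pP vp (prim_expr_order zp).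
have z0 : 0 < v (z - 1).
  rewrite lt_def v_ge0 // andbT; apply: contraTneq h1 => ->.
  by rewrite expr0n expn_eq0 gtn_eqF // -ltNge.
have : v (z - 1) ^+ (p ^ 2 * e) <= v (z - 1) ^+ (p ^ (e + 2)).
  apply: le_trans h1; rewrite ve exprM; apply: lerXn2r hz;
    by rewrite nnegrE ?exprn_ge0 // ltW.
rewrite leNgt ltr_iXn2l // expnD mulnC ltn_pmul2r ?expn_gt0 ?p0 //.
by rewrite ltn_expl // prime_gt1.
Qed.

(** The exponent [totient (p ^ C)] makes the power of the Frobenius conjugation trivial on roots of
    unity of order p^C, while it remains a p-power map on tame roots. *)
Lemma frobenius_conj_power C m : (0 < m)%N ->
  (forall c, c \in K -> v c <= 1 -> v (c ^+ (p ^ m) - c) < 1) ->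
  forall n s r t, n.-primitive_root t -> n = (p ^ s * r)%N -> (0 < s)%N -> coprime p r ->
  forall k, exists a, [/\ conj_over K t (t ^+ a), (a = 1 %[mod p ^ C])%N &
     (a = p ^ (m * totient (p ^ C) * k) %[mod r])%N].
Proof.
move=> m0 hm n s r t tp nE s0 pr k.
have [a ga ar] := frobenius_conj Hv pP vp tp nE pr (erefl _) hm.
exists (a ^ (totient (p ^ C) * k))%N; split.
- exact: conj_overX.
- rewrite expnM; apply: eq_mod_exp1; apply: Euler_exp_totient.
  rewrite coprimeXr //; apply: coprime_dvdr (conj_over_coprime tp ga).
  by rewrite nE dvdn_mulr // dvdn_exp.
- by rewrite -mulnA [(p ^ (m * _))%N]expnM -modnXm ar modnXm.
Qed.

Lemma prim_root_expz_eq1 N x (k : int) : N.-primitive_root x -> x ^ k = 1 -> (N %| absz k)%N.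
Proof.
move=> xp; case: k => k /eqP; first by rewrite -exprnP -(prim_order_dvd xp).
by rewrite NegzE -exprnN invr_eq1 -(prim_order_dvd xp).
Qed.

(* Fourier inversion over mu_N isolates the coefficients of index congruent to j. *)
Lemma fourier_coef f x y z w N (j : int) : tends0 v f -> v x = 1 ->
  N.-primitive_root z -> w ^+ N = 1 ->
  (forall l, eval_to v f (x * z ^+ l) (y * w ^+ l)) -> f j != 0 ->
  (forall i : int, (N <= absz (i - j))%N -> v (f i) < v (f j)) -> w = z ^ j.
Proof.
move=> hf vx zp wN hev fj hfar; apply/eqP; apply: contraT => wz.
have N0 := prim_order_gt0 zp; have zN := prim_expr_order zp.
have vz : v z = 1 := v_unity Hv N0 zN.
have z0 : z != 0 by rewrite -(v_gt0 Hv) vz.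
have x0 : x != 0 by rewrite -(v_gt0 Hv) vx.
have geo (g : Om) : g ^+ N = 1 -> g != 1 -> \sum_(l < N) g ^+ l = 0.
  move=> gN; rewrite -subr_eq0 => g1; apply: (mulfI g1).
  by rewrite -subrX1 gN subrr mulr0.
have zkN (k : int) : (z ^ k) ^+ N = 1.
  by rewrite exprnP exprz_exp mulrC -exprz_exp -exprnP zN exp1rz.
(* The inversion isolates N f_j, so the truncation error must be below |N f_j|. *)
pose d := v (f j) * v N%:R.
have d0 : 0 < d by rewrite mulr_gt0 ?char0_v_nat_gt0 // v_gt0.
have [D0 hD0] := hf d d0; pose D := maxn D0 `|j|.
have hD i : (D < `|i|)%N -> v (f i) < d by move=> h; apply: hD0; lia.
pose S l := partial_sum f (x * z ^+ l) D.
have hS l : v (y * w ^+ l - S l) < d.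
  apply: eval_approx hD => //; by rewrite vM // vX // vx vz expr1n mulr1.
(* The exact values contribute y times the sum of the powers of w z^(-j), an N-th root of unity
   other than 1, hence 0; only the truncation error is left. *)
have h1 : v (\sum_(l < N) (z ^ (- j)) ^+ l * S l) < d.
  have -> : \sum_(l < N) (z ^ (- j)) ^+ l * S l =
      - \sum_(l < N) (z ^ (- j)) ^+ l * (y * w ^+ l - S l).
    rewrite -sumrN; under [RHS]eq_bigr => l _ do rewrite -mulrN opprB mulrBr.
    rewrite sumrB; set T := \sum_(l < N) _ * (y * _).
    suff -> : T = 0 by rewrite subr0.
    rewrite /T; under eq_bigr => l _ do rewrite mulrCA -exprMn.
    rewrite -mulr_sumr geo ?mulr0 // ?exprMn ?zkN ?wN ?mulr1 //.
    apply: contra wz => /eqP h; apply/eqP.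
    by rewrite -[LHS]mul1r -(expr0z z) -(addrN j) expfzDr // -mulrA h mulr1.
  rewrite vN //; apply: v_sum_lt => // l _.
  by rewrite vM // vX // vXz // vz exp1rz expr1n mul1r.
have E : \sum_(l < N) (z ^ (- j)) ^+ l * S l = \sum_(i < D.*2.+1)
    f (i%:Z - D%:Z) * x ^ (i%:Z - D%:Z) * \sum_(l < N) (z ^ (i%:Z - D%:Z - j)) ^+ l.
  under eq_bigr => l _ do rewrite mulr_sumr.
  rewrite exchange_big; apply: eq_bigr => i _; rewrite mulr_sumr; apply: eq_bigr => l _.
  move: (i%:Z - D%:Z) => k; rewrite expfzMl expfzDr // exprMn.
  have -> : (z ^+ l) ^ k = (z ^ k) ^+ l by rewrite !exprnP !exprz_exp mulrC.
  ring.
rewrite E in h1.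
have jD : (absz (j + D%:Z)%R < D.*2.+1)%N by lia.
pose ij : 'I_(D.*2.+1) := Ordinal jD.
have ijE : (ij : nat)%:Z - D%:Z = j by rewrite /=; lia.
rewrite (bigD1 ij) //= ijE subrr expr0z in h1.
move: h1; set T := \sum_(i < D.*2.+1 | _) _ => h1.
(* Only indices congruent to j modulo N survive, and these are at distance at least N from j. *)
have hT : v T < d.
  apply: v_sum_lt => // i iij; set k := i%:Z - D%:Z.
  have kj : k - j != 0.
    by apply: contraNneq iij => kj; apply/eqP/val_inj => /=; move: kj; rewrite /k; lia.
  have [g1|g1] := eqVneq (z ^ (k - j)) 1; last by rewrite geo // mulr0 v0.
  have Nk : (N <= absz (k - j))%N.
    by apply: dvdn_leq; rewrite ?absz_gt0 //; exact: prim_root_expz_eq1 zp g1.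
  rewrite g1; under eq_bigr => l _ do rewrite expr1n.
  rewrite sumr_const card_ord !vM // vXz // vx exp1rz mulr1.
  by rewrite ltr_pM2r ?char0_v_nat_gt0 // hfar.
have : v (f j * x ^ j * N%:R) < d.
  rewrite -[_ * N%:R](addrK T); apply: vB_lt => //; move: h1.
  by under eq_bigr => l _ do rewrite expr1n; rewrite sumr_const card_ord.
by rewrite !vM // vXz // vx exp1rz mulr1 ltxx.
Qed.

Lemma unity_mul x y : in_mu_inf x -> in_mu_inf y -> in_mu_inf (x * y).
Proof.
move=> [a [a0 xa]] [b [b0 yb]]; exists (a * b)%N; rewrite muln_gt0 a0 b0; split=> //.
by rewrite exprMn exprM xa mulnC exprM yb !expr1n mulr1.
Qed.

Lemma unity_inv x : in_mu_inf x -> in_mu_inf x^-1.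
Proof. by move=> [a [a0 xa]]; exists a; rewrite exprVn xa invr1. Qed.

Lemma v_mu_inf x : in_mu_inf x -> v x = 1.
Proof. by move=> [a [a0 xa]]; exact: v_unity xa. Qed.

Lemma common_prim_root x y : in_mu_inf x -> in_mu_inf y ->
  exists n s r t i j, [/\ n.-primitive_root t, n = (p ^ s * r)%N, (0 < s)%N & coprime p r] /\
    (x = t ^+ i /\ y = t ^+ j).
Proof.
move=> [a [a0 xa]] [b [b0 yb]]; pose n := (a * b * p)%N.
have n0 : (0 < n)%N by rewrite !muln_gt0 a0 b0.
have [t tp] := prim_root_exists n0.
have [r pr nE] := pfactor_coprime pP n0.
have [|i xE] := prim_rootP tp (_ : x ^+ n = 1).
  by rewrite /n -mulnA exprM xa expr1n.
have [|j yE] := prim_rootP tp (_ : y ^+ n = 1).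
  by rewrite /n mulnAC mulnC exprM yb expr1n.
exists n, (logn p n), r, t, i, j; split=> //; split=> //; first by rewrite mulnC.
by rewrite logn_gt0 mem_primes pP n0 dvdn_mull.
Qed.

(** * Special values, conjugation and monomials *)

Section Galois.
Hypothesis K_complete : forall u, (forall n, u n \in K) -> cauchy v u ->
  exists2 l, l \in K & cvg_to v u l.
Variables (f : int -> Om) (C0 : nat).
Hypothesis fK : forall n, f n \in K.
Hypothesis f0 : tends0 v f.
Hypothesis big_gal : forall C, (C0 <= C)%N ->
  forall n s r t, n.-primitive_root t -> n = (p ^ s * r)%N ->
  coprime p r -> forall b, (b = 1 %[mod r * p ^ C])%N -> conj_over K t (t ^+ b).

Definition special_value x y : Prop := [/\ in_mu_inf x, eval_to v f x y & in_mu_inf y].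

Definition wild_of_level m x : Prop := forall N, (0 < N)%N -> x ^+ N = 1 -> (p ^ m %| N)%N.

(** Given two nonzero coefficients f_i and f_j, choose D beyond which coefficients are smaller than
    both. Level C0 + m leaves z = x^(r p^C0) with order N > m = D + |i| + |j|, so Fourier inversion
    applies at both indices: z^i = w = z^j, and N divides i - j. *)
Lemma monomial_of_wild_values :
  (forall m, exists x, wild_of_level m x /\ exists y, special_value x y) ->
  forall i j, f i != 0 -> f j != 0 -> i = j.
Proof.
move=> hw i j fi fj; apply/eqP; apply: contraT => ij.
pose d := Num.min (v (f i)) (v (f j)).
have d0 : 0 < d by rewrite lt_min !v_gt0 // fi.
have [D hD] := f0 d0.
pose m := (D + absz i + absz j)%N.
have [x [xw [y [xm xy ym]]]] := hw (C0 + m)%N.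
have [n [s [r [t [a [b [[tp nE s0 pr] [xE yE]]]]]]]] := common_prim_root xm ym.
have n0 := prim_order_gt0 tp; have tn := prim_expr_order tp.
have r0 : (0 < r)%N by move: n0; rewrite nE muln_gt0 => /andP[].
pose u := (r * p ^ C0)%N; pose z := x ^+ u; pose w := y ^+ u.
have ev l : eval_to v f (x * z ^+ l) (y * w ^+ l).
  have g : conj_over K t (t ^+ (1 + l * u)).
    by apply: (big_gal (leqnn C0) tp nE pr); rewrite addnC modnMDl.
  have := conj_eval Hv K_complete (i := a) (j := b) fK n0 tn g.
  rewrite ![(t ^+ (1 + l * u)) ^+ _]exprAC -xE -yE => /(_ xy).
  by rewrite !exprD !expr1 mulnC !(exprM _ u).
have zn : z ^+ n = 1 by rewrite /z xE [_ ^+ n]exprAC [_ ^+ n]exprAC tn !expr1n.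
have [N zp Nn] := prim_order_exists n0 zn.
have N0 := prim_order_gt0 zp.
have hN : (p ^ m %| N)%N.
  have : (p ^ (C0 + m) %| u * N)%N.
    apply: xw; first by rewrite !muln_gt0 r0 expn_gt0 p0.
    by rewrite exprM (prim_expr_order zp).
  rewrite /u -mulnA Gauss_dvdr; last by rewrite coprimeXl.
  by rewrite expnD dvdn_pmul2l // expn_gt0 p0.
have mN : (m < N)%N.
  by apply: leq_trans (dvdn_leq N0 hN); rewrite ltn_expl // prime_gt1.
have wN : w ^+ N = 1.
  have := ev N; rewrite (prim_expr_order zp) mulr1 => e.
  have y0 : y != 0 by rewrite -(v_gt0 Hv) (v_mu_inf ym).
  by apply: (mulfI y0); rewrite mulr1; apply: (cvg_to_uniq Hv e).
have far k k' : d <= v (f k) -> (absz k <= absz i + absz j)%N ->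
    (N <= absz (k' - k))%N -> v (f k') < v (f k).
  by move=> h1 h2 h3; apply: lt_le_trans h1; apply: hD; lia.
have wi : w = z ^ i.
  apply: (fourier_coef f0 (v_mu_inf xm) zp wN ev fi) => k; apply: far.
    by rewrite ge_min lexx.
  by rewrite leq_addr.
have wj : w = z ^ j.
  apply: (fourier_coef f0 (v_mu_inf xm) zp wN ev fj) => k; apply: far.
    by rewrite ge_min lexx orbT.
  by rewrite leq_addl.
have z0 : z != 0 by rewrite -(v_gt0 Hv) (v_unity Hv N0 (prim_expr_order zp)).
have : z ^ (i - j) = 1.
  rewrite expfzDr // -wi wj -expfzDr // addrN expr0z //.
move/(prim_root_expz_eq1 zp)/dvdn_leq; rewrite absz_gt0 subr_eq0 => /(_ ij).
lia.
Qed.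

(** For a shifted truncation T of g, the polynomial T(X^Q) - T(X)^Q is small at infinitely many tame
    roots, so its coefficients are small and it is small on the whole unit sphere. Both terms carry
    the same shift X^(DQ). *)
Lemma power_identity (g : int -> Om) Q : tends0 v g ->
  (forall s : seq Om, exists w, w \notin s /\ (tame_root v w /\
     exists y, [/\ v y <= 1, eval_to v g w y & eval_to v g (w ^+ Q) (y ^+ Q)])) ->
  forall x y y', v x = 1 -> eval_to v g x y -> eval_to v g (x ^+ Q) y' -> y' = y ^+ Q.
Proof.
move=> g0 hw x y y' vx ev ev'; apply/eqP; rewrite -subr_eq0; apply/eqP.
apply: (v_eps0 Hv) => e e0.
(* At the target point y may exceed 1 in absolute value; taking Q-th powers then enlarges an error d
   to at most d B^Q, which the choice of d keeps below e. *)
pose B := Num.max 1 (v y).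
have B1 : 1 <= B by rewrite le_max lexx.
have yB : v y <= B by rewrite le_max lexx orbT.
have BQ : 1 <= B ^+ Q by rewrite exprn_ege1.
have BQ0 : 0 < B ^+ Q by rewrite (lt_le_trans ltr01).
pose d := Num.min 1 (e / B ^+ Q).
have d0 : 0 < d by rewrite lt_min ltr01 divr_gt0.
have d1 : d <= 1 by rewrite ge_min lexx.
have dB : d * B ^+ Q <= e by rewrite -ler_pdivlMr // ge_min lexx orbT.
have de : d <= e by apply: le_trans dB; rewrite ler_peMr // ltW.
have [D hD] := g0 d d0.
pose a z := partial_sum g z D.
pose P : {poly Om} := shifted_trunc g D \Po 'X^Q - shifted_trunc g D ^+ Q.
have vP z : v z = 1 -> v P.[z] = v (a (z ^+ Q) - a z ^+ Q).
  move=> vz; have z0 : z != 0 by rewrite -(v_gt0 Hv) vz.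
  rewrite /a !partial_sum_horner ?expf_neq0 // exprMn exprVn -[_ ^+ D ^+ Q]exprM.
  rewrite -[_ ^+ Q ^+ D]exprM [(D * Q)%N]mulnC -mulrBr vM // vV // vX // vz expr1n.
  by rewrite invr1 mul1r !hornerE horner_comp !hornerE.
have apx z u B' : v z = 1 -> 1 <= B' -> v u <= B' -> eval_to v g z u ->
    v (a z ^+ Q - u ^+ Q) <= d * B' ^+ Q.
  move=> vz B'1 uB h; have hz : v (u - a z) < d by exact: eval_approx h vz d0 hD.
  have B'0 : 0 <= B' ^+ Q by rewrite exprn_ge0 // (le_trans ler01).
  apply: le_trans (v_powB Hv Q B'1 _ uB) _; last first.
    by apply: ler_wpM2r => //; rewrite vC // ltW.
  rewrite -[a z](subKr u); apply: vB_le => //.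
  by rewrite (le_trans (ltW hz)) // (le_trans d1).
have hP k : v P`_k <= d.
  apply: (coef_le_of_tame_values Hv (ltW d0)) => s.
  have [w [ws [tw [u [u1 eu eu']]]]] := hw s; exists w; split=> //; split=> //.
  have vw := v_tame Hv tw; rewrite vP //.
  apply: (v_dist_le Hv (y := u ^+ Q)).
    by rewrite vC //; apply/ltW/(eval_approx Hv eu' _ d0 hD); rewrite vX // vw expr1n.
  by rewrite vC //; have := apx w u 1 vw (lexx _) u1 eu; rewrite expr1n mulr1.
apply: (v_dist_le Hv (y := a (x ^+ Q))).
  by apply: le_trans de; apply/ltW/(eval_approx Hv ev' _ d0 hD); rewrite vX // vx expr1n.
apply: (v_dist_le Hv (y := a x ^+ Q)).
  by rewrite -vP // (le_trans _ de) // v_horner_le ?(ltW d0) // vx.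
exact: le_trans (apx x y B vx B1 yB ev) dB.
Qed.

Section Tame.
Hypothesis v_complete : complete_abs v.
Variables (m C : nat).
Hypothesis m_gt0 : (0 < m)%N.
Hypothesis residue_frob : forall c, c \in K -> v c <= 1 -> v (c ^+ (p ^ m) - c) < 1.
Hypothesis C0C : (C0 <= C)%N.

Definition frob_exp k := (p ^ (m * totient (p ^ C) * k))%N.

(** The p-part of the order of x divides p^C. Conjugation by 1 + p^C r fixes x, hence its value y,
    so p^C r kills y as well. The Chinese remainder theorem splits both into p-parts z, z' and tame
    parts w, w', and a power of the Frobenius conjugation fixes the former and raises the latter to
    the power [frob_exp k]. *)
Lemma tame_decomposition m0 x y : (m0 <= C)%N -> special_value x y -> ~ wild_of_level m0 x ->
  exists w w' z z', [/\ x = z * w, z ^+ (p ^ C) = 1, z' ^+ (p ^ C) = 1,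
    tame_root v w /\ tame_root v w' &
    forall k, eval_to v f (z * w ^+ frob_exp k) (z' * w' ^+ frob_exp k)].
Proof.
move=> m0C [xm xy ym] xw.
have [n [s [r [t [a [b [[tp nE s0 pr] [xE yE]]]]]]]] := common_prim_root xm ym.
have n0 := prim_order_gt0 tp; have tn := prim_expr_order tp.
have r0 : (0 < r)%N by move: n0; rewrite nE muln_gt0 => /andP[].
have xn : x ^+ n = 1 by rewrite xE exprAC tn expr1n.
have gev l : conj_over K t (t ^+ l) -> eval_to v f (x ^+ l) (y ^+ l).
  move=> g; have := conj_eval Hv K_complete (i := a) (j := b) fK n0 tn g.
  by rewrite ![(t ^+ l) ^+ _]exprAC -xE -yE; apply.
have xr : x ^+ (p ^ C * r) = 1.
  move/existsNP: xw => [N /not_implyP[N0 /not_implyP[xN /negP pN]]].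
  have [d xp dn] := prim_order_exists n0 xn.
  have d0 := prim_order_gt0 xp.
  have [r' pr' dE] := pfactor_coprime pP d0.
  have dN : (d %| N)%N by rewrite (prim_order_dvd xp) xN.
  have ld : (logn p d < m0)%N.
    rewrite ltnNge -pfactor_dvdn //; apply: contra pN => h; exact: dvdn_trans dN.
  apply/eqP; rewrite -(prim_order_dvd xp) dE mulnC; apply: dvdn_mul.
    by rewrite dvdn_exp2l // ltnW // (leq_trans ld).
  have : (r' %| p ^ s * r)%N by rewrite -nE; apply: dvdn_trans dn; rewrite dE dvdn_mulr.
  by rewrite Gauss_dvdr // coprime_sym coprimeXl.
have yr : y ^+ (p ^ C * r) = 1.
  have h : (1 + p ^ C * r = 1 %[mod r * p ^ C])%N by rewrite [(r * _)%N]mulnC modnDr.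
  have := gev _ (big_gal C0C tp nE pr h).
  rewrite !exprD !expr1 xr mulr1 => e.
  have y0 : y != 0 by rewrite -(v_gt0 Hv) (v_mu_inf ym).
  by apply: (mulfI y0); rewrite mulr1; apply: (cvg_to_uniq Hv e).
have cop : coprime (p ^ C) r by rewrite coprimeXl.
pose e1 := chinese (p ^ C) r 1 0; pose e2 := chinese (p ^ C) r 0 1.
have e1p : (e1 = 1 %[mod p ^ C])%N := chinese_modl cop 1 0.
have e1r : (e1 = 0 %[mod r])%N := chinese_modr cop 1 0.
have e2p : (e2 = 0 %[mod p ^ C])%N := chinese_modl cop 0 1.
have e2r : (e2 = 1 %[mod r])%N := chinese_modr cop 0 1.
have re1 : (r %| e1)%N by rewrite /dvdn e1r mod0n.
have pe2 : (p ^ C %| e2)%N by rewrite /dvdn e2p mod0n.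
have dec u : u ^+ (p ^ C * r) = 1 -> [/\ u = u ^+ e1 * u ^+ e2,
    (u ^+ e1) ^+ (p ^ C) = 1, (u ^+ e2) ^+ r = 1 & tame_root v (u ^+ e2)].
  move=> hu; have h1 : (u ^+ e1) ^+ (p ^ C) = 1.
    by have /dvdnP[q ->] := re1; rewrite -exprM -mulnA mulnC [(r * _)%N]mulnC exprM hu expr1n.
  have h2 : (u ^+ e2) ^+ r = 1.
    by have /dvdnP[q ->] := pe2; rewrite -exprM -mulnA mulnC exprM hu expr1n.
  split=> //; last by exists r; rewrite (v_nat_coprime Hv pP vp).
  rewrite -exprD -(expr_mod (e1 + e2) hu) -[LHS]expr1 -(expr_mod 1 hu); congr (_ ^+ _).
  apply: chinese_eq => //; rewrite -modnDm ?e1p ?e2p ?e1r ?e2r mod0n ?addn0 ?add0n modn_mod //.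
have [xd x1 x2 xt] := dec x xr; have [yd y1 y2 yt] := dec y yr.
exists (x ^+ e2), (y ^+ e2), (x ^+ e1), (y ^+ e1); split=> // k.
have [l [gl lp lr]] := frobenius_conj_power C m_gt0 residue_frob tp nE s0 pr k.
have pw (u : Om) : (u ^+ e1) ^+ (p ^ C) = 1 -> (u ^+ e2) ^+ r = 1 -> u = u ^+ e1 * u ^+ e2 ->
    u ^+ l = u ^+ e1 * (u ^+ e2) ^+ frob_exp k.
  move=> h1 h2 ud; rewrite [X in X ^+ l]ud exprMn; congr (_ * _).
    by rewrite -(expr_mod l h1) lp (expr_mod _ h1) expr1.
  by rewrite -(expr_mod l h2) lr (expr_mod _ h2).
by rewrite -!pw //; exact: gev.
Qed.

(* The functional equation g(x^Q) = g(x)^Q, obtained on infinitely many tame roots of unity,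
   holds on the whole unit sphere and so produces special values at wild roots of unity. *)
Lemma wild_values_of_tame m0 : (m0 <= C)%N ->
  (forall s : seq Om, exists x, x \notin s /\ exists y, special_value x y) ->
  (forall x y, special_value x y -> ~ wild_of_level m0 x) ->
  forall k, exists x, wild_of_level k x /\ exists y, special_value x y.
Proof.
move=> m0C hinf hnw k.
have pC0 : (0 < p ^ C)%N by rewrite expn_gt0 p0.
have [t tp] := prim_root_exists pC0.
pose mu := [seq t ^+ i | i <- iota 0 (p ^ C)].
have mem_mu z : z ^+ (p ^ C) = 1 -> z \in mu.
  by move=> /(prim_rootP tp)[i ->]; apply: map_f; rewrite mem_iota /=.
have mu_unity z : z \in mu -> z ^+ (p ^ C) = 1.
  by move=> /mapP[i _ ->]; rewrite exprAC (prim_expr_order tp) expr1n.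
pose Good w (zz : Om * Om) := tame_root v w /\ exists2 w', tame_root v w' &
   forall k, eval_to v f (zz.1 * w ^+ frob_exp k) (zz.2 * w' ^+ frob_exp k).
have [[z z']] : exists2 zz, zz \in [seq (a, b) | a <- mu, b <- mu] &
    forall s : seq Om, exists w, w \notin s /\ Good w zz.
  (* There are finitely many pairs of p-parts, so one pair (z, z') serves infinitely many tame parts
     w. *)
  apply: pigeonhole_inf => s.
  have [x [xs [y sp]]] := hinf [seq a * b | a <- mu, b <- s].
  have [w [w' [z [z' [xE zC z'C [tw tw'] hk]]]]] := tame_decomposition m0C sp (hnw _ _ sp).
  exists w; split.
    by apply: contra xs => ws; rewrite xE; apply: allpairs_f => //; exact: mem_mu.
  exists (z, z'); first by apply: allpairs_f; exact: mem_mu.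
  by split=> //; exists w'.
case/allpairsP=> -[z1 z2] [/= /mu_unity zC /mu_unity z'C [zE z'E]].
rewrite -{}zE -{}z'E in zC z'C => hG.
have vz : v z = 1 := v_unity Hv pC0 zC.
have vz' : v z' = 1 := v_unity Hv pC0 z'C.
have z0 : z != 0 by rewrite -(v_gt0 Hv) vz.
have z'0 : z' != 0 by rewrite -(v_gt0 Hv) vz'.
(* The twist g(X) = f(zX) / z' absorbs the p-parts, so that g(w) = w' and g(w^Q) = w'^Q. *)
pose g i := f i * z ^ i / z'.
have vg i : v (g i) = v (f i) by rewrite !vM // vV // vXz // vz vz' exp1rz invr1 !mulr1.
have g0 : tends0 v g.
  by move=> e e0; have [N hN] := f0 e0; exists N => i hi; rewrite vg hN.
have gE x y : eval_to v f (z * x) y -> eval_to v g x (y / z').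
  move=> h e e0; have [N hN] := h e e0; exists N => q /hN.
  have -> : partial_sum g x q = partial_sum f (z * x) q / z'.
    rewrite /partial_sum mulr_suml; apply: eq_bigr => i _.
    by rewrite /g expfzMl; ring.
  by rewrite -mulrBl vM // vV // vz' invr1 mulr1.
have [w [_ [tw [w' tw' hk]]]] := hG [::].
have pCk0 : (0 < p ^ (C + k))%N by rewrite expn_gt0 p0.
have [e ep] := prim_root_exists pCk0.
(* Q is a multiple of p^(C+k), so e^Q = 1 and (we)^Q = w^Q; the functional equation gives g(we)^Q =
   w'^Q, and g(we) is a root of unity. *)
pose Q := frob_exp (C + k).
have eQ : e ^+ Q = 1.
  apply/eqP; rewrite -(prim_order_dvd ep) dvdn_exp2l // leq_pmull // muln_gt0 m_gt0.
  by rewrite totient_gt0.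
have v_e : v e = 1 := v_unity Hv (prim_order_gt0 ep) (prim_expr_order ep).
have vx : v (w * e) = 1 by rewrite vM // v_e (v_tame Hv tw) mulr1.
have [|y hy] := eval_to_exists Hv v_complete f0 (x := z * (w * e)).
  by rewrite vM // vz vx mulr1.
have hy' : eval_to v g ((w * e) ^+ Q) (w' ^+ Q).
  have := gE _ _ (hk (C + k)%N); rewrite /= mulrAC divff // mul1r.
  by rewrite exprMn eQ mulr1.
have yw : w' ^+ Q = (y / z') ^+ Q.
  apply: (power_identity g0 _ vx (gE _ _ hy) hy') => s.
  have [u [us [tu [u' tu' hku]]]] := hG s; exists u; split=> //; split=> //.
  exists u'; split; first by rewrite (v_tame Hv tu').
    have := gE _ _ (hku 0%N); rewrite /= /frob_exp muln0 !expr1.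
    by rewrite mulrAC divff // mul1r.
  by have := gE _ _ (hku (C + k)%N); rewrite /= mulrAC divff // mul1r.
have muz : in_mu_inf z by exists (p ^ C)%N.
have tame_mu u : tame_root v u -> in_mu_inf u.
  by move=> [r [hr ur]]; exists r; split=> //; exact: tame_gt0 hr.
have mue : in_mu_inf e.
  by exists (p ^ (C + k))%N; split; [exact: prim_order_gt0 ep | exact: prim_expr_order].
exists (z * (w * e)); split.
  (* If N kills z w e, then p^C r N kills e, which has order p^(C+k); since r is prime to p, p^k
     divides N. *)
  move=> N N0 xN; have [r [hr wr]] := tw.
  have pr : coprime p r.
    rewrite prime_coprime //; apply: contraTN vp => /dvdnP[q rE].
    rewrite -leNgt -hr rE natrM vM // ler_piMl ?v_ge0 ?v_nat //.
  have : e ^+ (p ^ C * (r * N)) = 1.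
    have : (z * (w * e)) ^+ (p ^ C * (r * N)) = 1.
      by rewrite mulnA mulnC exprM xN expr1n.
    have zN : z ^+ (p ^ C * (r * N)) = 1 by rewrite exprM zC expr1n.
    have wN : w ^+ (p ^ C * (r * N)) = 1 by rewrite mulnCA exprM wr expr1n.
    by rewrite !exprMn zN wN !mul1r.
  move/eqP; rewrite -(prim_order_dvd ep) expnD dvdn_pmul2l // Gauss_dvdr //.
  by rewrite coprimeXl.
exists y; split=> //; first by apply: unity_mul => //; apply: unity_mul => //; exact: tame_mu.
rewrite -[y](divfK z'0); apply: unity_mul; last by exists (p ^ C)%N.
have [r [r0 wr]] := tame_mu _ tw'.
exists (Q * r)%N; rewrite muln_gt0 r0 expn_gt0 p0; split=> //.
by rewrite exprM -yw exprAC wr expr1n.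
Qed.
End Tame.
End Galois.
End CharZero.

(** * Positive characteristic *)

Section CharP.
Variables (R : realType) (Om : closedFieldType) (v : Om -> R).
Hypothesis Hv : nonarch_abs v.
Variables (K : divringClosed Om) (p : nat).
Hypothesis char_p : p \in [pchar Om].
Implicit Types (x y : Om).

Let pP : prime p := pcharf_prime char_p.
Let vp : v p%:R < 1.
Proof. by rewrite (pcharf0 char_p) v0. Qed.

(** Membership in a finite field of order p^m, that is, in the algebraic closure of F_p. *)
Definition frob_periodic x : Prop := exists2 m, (0 < m)%N & x ^+ (p ^ m) = x.

Lemma frob_iter x m k : x ^+ (p ^ m) = x -> x ^+ (p ^ (m * k)) = x.
Proof. by move=> h; elim: k => [|k IH]; rewrite ?muln0 // mulnS expnD exprM h. Qed.

Lemma frob_periodic_common x y : frob_periodic x -> frob_periodic y ->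
  exists m, [/\ (0 < m)%N, x ^+ (p ^ m) = x & y ^+ (p ^ m) = y].
Proof.
move=> [a a0 xa] [b b0 yb]; exists (a * b)%N; rewrite muln_gt0 a0 b0 frob_iter //.
by rewrite mulnC frob_iter.
Qed.

Lemma frob_periodicD x y : frob_periodic x -> frob_periodic y -> frob_periodic (x + y).
Proof.
move=> hx hy; have [m [m0 xm ym]] := frob_periodic_common hx hy.
exists m => //; rewrite exprDn_pchar ?xm ?ym //.
by rewrite pnatX pnatE // char_p.
Qed.

Lemma frob_periodicM x y : frob_periodic x -> frob_periodic y -> frob_periodic (x * y).
Proof.
move=> hx hy; have [m [m0 xm ym]] := frob_periodic_common hx hy.
by exists m => //; rewrite exprMn xm ym.
Qed.

Lemma frob_periodicN1 : frob_periodic (-1).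
Proof.
by exists 1%N; rewrite // expn1 exprNn_pchar ?pnatE // expr1n.
Qed.

Lemma frob_periodic0 : frob_periodic 0.
Proof. by exists 1%N => //; rewrite expr0n expn_eq0 gtn_eqF // prime_gt0. Qed.

Lemma frob_periodicXz x (k : int) : frob_periodic x -> frob_periodic (x ^ k).
Proof.
move=> [m m0 h]; exists m => //.
by rewrite exprnP exprz_exp mulrC -exprz_exp -exprnP h.
Qed.

Lemma v_frob_periodic x : frob_periodic x -> x != 0 -> v x = 1.
Proof.
move=> [m m0 h] x0; have q1 : (1 < p ^ m)%N by rewrite -[1%N](expn0 p) ltn_exp2l ?prime_gt1.
apply: (v_unity Hv (n := (p ^ m).-1)); first by lia.
by apply: (mulfI x0); rewrite -exprS mulr1 prednK // ltnW.
Qed.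

(** In characteristic p, x^(r p^a) - 1 = (x^r - 1)^(p^a). *)
Lemma unity_tame x : in_mu_inf x -> tame_root v x.
Proof.
move=> [n [n0 xn]]; have [r pr nE] := pfactor_coprime pP n0.
exists r; split; first exact: (v_nat_coprime Hv pP vp).
have /eqP : (x ^+ r - 1) ^+ (p ^ logn p n) = 0.
  have q : [pchar Om].-nat (p ^ logn p n)%N by rewrite pnatX pnatE // char_p.
  by rewrite exprDn_pchar // exprNn_pchar // expr1n -exprM -nE xn subrr.
by rewrite expf_eq0 subr_eq0 => /andP[_ /eqP].
Qed.

Lemma unity_frob_periodic x : in_mu_inf x -> frob_periodic x.
Proof.
move=> /unity_tame[r [hr xr]]; have r0 := tame_gt0 Hv hr.
exists (totient r); first by rewrite totient_gt0.
have pr : coprime p r.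
  rewrite prime_coprime //; apply: contraTN isT => /dvdnP[q rE].
  by move: hr; rewrite rE natrM (pcharf0 char_p) mulr0 v0 // => /esym/eqP; rewrite oner_eq0.
by rewrite -(expr_mod _ xr) Euler_exp_totient // (expr_mod _ xr) expr1.
Qed.

Lemma frob_periodic_algebraic x : frob_periodic x -> algebraic_over_prime x.
Proof.
move=> [m m0 h]; have q1 : (1 < p ^ m)%N by rewrite -[1%N](expn0 p) ltn_exp2l ?prime_gt1.
exists ('X^(p ^ m) - 'X); split.
- apply/eqP => /(congr1 (fun P : {poly Om} => P`_(p ^ m))) /eqP.
  by rewrite coefB coefXn coefX eqxx gtn_eqF // subr0 coef0 oner_eq0.
- move=> i; rewrite coefB coefXn coefX; case: (i == p ^ m)%N; case: (i == 1)%N.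
  + by exists 0%N; rewrite subrr.
  + by exists 1%N; rewrite subr0.
  + exists p.-1; rewrite sub0r; apply/eqP; rewrite eq_sym -addr_eq0 natr1.
    by rewrite prednK ?prime_gt0 // (pcharf0 char_p).
  + by exists 0%N; rewrite subr0.
- by rewrite /root !hornerE h subrr.
Qed.

(** The small number c^(p^m) - c is the product of the c - b over the roots b of X^(p^m) - X, so one
    factor is small. *)
Lemma frob_periodic_near c m : (0 < m)%N -> v (c ^+ (p ^ m) - c) < 1 ->
  exists2 b, frob_periodic b & v (c - b) < 1.
Proof.
move=> m0; have q1 : (1 < p ^ m)%N by rewrite -[1%N](expn0 p) ltn_exp2l ?prime_gt1.
pose P : {poly Om} := 'X^(p ^ m) - 'X.
have Pm : P \is monic.
  rewrite monicE lead_coefDl ?lead_coefXn // size_polyXn size_polyN size_polyX //.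
have [rs E] := closed_field_poly_normal P.
rewrite (eqP Pm) scale1r in E.
have -> : c ^+ (p ^ m) - c = P.[c] by rewrite !hornerE.
rewrite E horner_prod => /(v_prod_lt1 Hv)[b brs]; rewrite !hornerE => hb.
exists b => //; exists m => //.
have : root P b by rewrite E root_prod_XsubC.
by rewrite /root !hornerE subr_eq0 => /eqP.
Qed.

Variable f : int -> Om.
Hypothesis fK : forall n, f n \in K.
Hypothesis f0 : tends0 v f.
Variable m : nat.
Hypothesis m_gt0 : (0 < m)%N.
Hypothesis residue_frob : forall c, c \in K -> v c <= 1 -> v (c ^+ (p ^ m) - c) < 1.

Lemma partial_sumB (g h : int -> Om) x N :
  partial_sum (fun n => g n - h n) x N = partial_sum g x N - partial_sum h x N.
Proof. by rewrite /partial_sum -sumrB; apply: eq_bigr => i _; rewrite mulrBl. Qed.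

Lemma partial_sum_finite (g : int -> Om) x D N : (forall n : int, (D < `|n|)%N -> g n = 0) ->
  (D <= N)%N -> partial_sum g x N = partial_sum g x D.
Proof.
move=> hg; elim: N => [|N IH]; first by rewrite leqn0 => /eqP->.
rewrite leq_eqVlt => /orP[/eqP->//|]; rewrite ltnS => DN.
by rewrite partial_sumS IH // !hg ?mul0r ?addr0 //; lia.
Qed.

(** The difference h of f and its lift b has coefficients below 1. Its value z at a root of unity is
    algebraic over F_p because the lift is a finite sum; as |z| < 1, z = 0. Vanishing at infinitely
    many tame roots then kills h. *)
Lemma constant_coefficients :
  (forall s : seq Om, exists x, x \notin s /\ exists y, special_value v f x y) ->
  exists2 D : nat, forall n : int, (D < `|n|)%N -> f n = 0 &
    forall n, frob_periodic (f n).
Proof.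
move=> hinf.
have f1 : forall n, v (f n) <= 1.
  apply: (coef_le_of_tame_evals Hv f0 ltr01) => s.
  have [x [xs [y [xm xy ym]]]] := hinf s; exists x; split=> //; split; first exact: unity_tame.
  by exists y => //; rewrite (v_mu_inf Hv ym).
have [D hD] := f0 ltr01.
(* Beyond D the lift is chosen to be 0, which makes it a Laurent polynomial. *)
have /choice[b hb] : forall n : int, exists b, [/\ frob_periodic b, v (f n - b) < 1 &
    (D < `|n|)%N -> b = 0].
  move=> n; have [Dn|nD] := ltnP D `|n|.
    by exists 0; rewrite subr0; split=> //; [exact: frob_periodic0 | exact: hD].
  have [b pb fb] := frob_periodic_near m_gt0 (residue_frob (fK n) (f1 n)).
  by exists b; split=> //; rewrite ltnNge nD.
have b0 n : (D < `|n|)%N -> b n = 0 by case: (hb n).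
pose h n := f n - b n.
have h1 n : v (h n) < 1 by case: (hb n).
have h0 : tends0 v h.
  move=> e e0; have [N hN] := f0 e0; exists (maxn D N) => n hn.
  by rewrite /h b0 ?subr0 ?hN //; lia.
suff hz n : h n = 0.
  exists D => [n Dn|n]; first by have := hz n; rewrite /h b0 // subr0.
  by have /eqP := hz n; rewrite subr_eq0 => /eqP->; case: (hb n).
apply: (v_eps0 Hv) => e e0; move: n.
apply: (coef_le_of_tame_evals Hv h0 e0) => s.
have [x [xs [y [xm xy ym]]]] := hinf s; exists x; split=> //.
have xt := unity_tame xm; split=> //.
pose z := y - partial_sum b x D.
have hz : eval_to v h x z.
  move=> d d0; have [N hN] := xy d d0; exists (maxn D N) => k hk.
  rewrite partial_sumB (partial_sum_finite x b0); last by lia.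
  by rewrite /z opprB addrA subrK; apply: hN; lia.
exists z => //; suff -> : z = 0 by rewrite v0 // ltW.
have pz : frob_periodic z.
  apply: frob_periodicD; first exact: unity_frob_periodic.
  rewrite -mulN1r; apply: frob_periodicM; first exact: frob_periodicN1.
  rewrite /partial_sum; elim/big_ind: _; [exact: frob_periodic0 | exact: frob_periodicD |].
  move=> i _; apply: frob_periodicM; first by case: (hb (i%:Z - D%:Z)).
  exact/frob_periodicXz/unity_frob_periodic.
apply/eqP; apply: contraT => /(v_frob_periodic pz) vz.
have [D' hD'] := h0 1 ltr01.
have : v z < 1.
  rewrite -(subrK (partial_sum h x D') z); apply: vD_lt => //.
    exact: (eval_approx Hv hz (v_tame Hv xt) ltr01 hD').
  apply: v_sum_lt => // i _; rewrite vM // vXz // (v_tame Hv xt) exp1rz mulr1; exact: h1.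
by rewrite vz ltxx.
Qed.

End CharP.

(** * Assembly of the two characteristics *)

Lemma monomial_special (R : realType) (Om : closedFieldType) (v : Om -> R) (f : int -> Om) :
  nonarch_abs v -> [pchar Om] =i pred0 -> (exists x y, special_value v f x y) ->
  (forall i j, f i != 0 -> f j != 0 -> i = j) -> special f.
Proof.
move=> Hv char0 [x [y [xm xy ym]]] hf; left; split=> //.
have vx := v_mu_inf Hv xm; have x0 : x != 0 by rewrite -(v_gt0 Hv) vx.
have [k fk] : exists k, f k != 0.
  apply: contrapT => hno; have fz n : f n = 0.
    by apply/eqP; apply: contraT => fn; case: hno; exists n.
  suff y0 : y = 0 by move: (v_mu_inf Hv ym); rewrite y0 v0 // => /esym/eqP; rewrite oner_eq0.
  apply: (cvg_to_uniq Hv xy) => e e0; exists 0%N => n _.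
  by rewrite subr0 /partial_sum big1 ?v0 // => i _; rewrite fz mul0r.
have fE n : f n = if n == k then f k else 0.
  have [->//|nk] := eqVneq n k; apply/eqP; apply: contraT => fn.
  by rewrite (hf n k fn fk) eqxx in nk.
exists (f k), k; split=> //.
have yE : y = f k * x ^ k.
  apply: (cvg_to_uniq Hv xy) => e e0; exists (absz k) => n hn.
  have kn : (absz (k + n%:Z)%R < n.*2.+1)%N by lia.
  rewrite /partial_sum (bigD1 (Ordinal kn)) //=.
  have -> : (absz (k + n%:Z))%:Z - n%:Z = k by lia.
  rewrite addrAC subrr add0r big1 ?v0 // => i ik; rewrite fE ifN ?mul0r //.
  by apply: contraNneq ik => h; apply/eqP/val_inj => /=; lia.
have -> : f k = y * (x ^ k)^-1 by rewrite yE mulfK // expfz_neq0.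
apply: unity_mul => //; apply: unity_inv; have [a [a0 xa]] := xm; exists a; split=> //.
by rewrite exprnP exprz_exp mulrC -exprz_exp -exprnP xa exp1rz.
Qed.

Theorem theoremA (R : realType) (Om : closedFieldType) (v : Om -> R)
    (K : pred Om) (f : int -> Om) :
  nonarch_abs v -> complete_abs v ->
  is_local_field v K -> alg_dense v K ->
  in_A11 v K f ->
  (forall s : seq Om, exists xi : Om,
      [/\ xi \notin s, in_mu_inf xi &
          exists y, eval_to v f xi y /\ in_mu_inf y]) ->
  special f.
Proof.
move=> Hv v_complete [[K0 K1 KB KM KV] K_complete [pi0 piK [/andP[pi_gt0 pi_lt1] hpi]] [s [_ hs]]] _.
move=> [fK f0] hinf.
have Kdiv : divring_closed K.
  by split=> // x y xK yK; apply: KM => //; exact: KV.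
pose K' : divringClosed Om := HB.pack K (GRing.isDivringClosed.Build Om K Kdiv).
have {}hinf (l : seq Om) : exists x, x \notin l /\ exists y, special_value v f x y.
  by have [x [xl xm [y [xy ym]]]] := hinf l; exists x; split=> //; exists y.
have fK' n : f n \in K' by exact: fK.
have hs' x : x \in K' -> v x <= 1 -> exists2 a, a \in s & v (x - a) < 1 by exact: hs.
have [[p char_p]|nochar] := pselect (exists p, p \in [pchar Om]).
  have vp : v p%:R < 1 by rewrite (pcharf0 char_p) v0.
  have [m m0 hm] := residue_power Hv hs' (pcharf_prime char_p) vp.
  have [D hD hf] := constant_coefficients Hv char_p fK' f0 m0 hm hinf.
  right; split; first by exists p.
  split; first by exists D.
  by move=> n; exact: frob_periodic_algebraic (hf n).
have char0 : [pchar Om] =i pred0.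
  by move=> p; apply/negP => char_p; apply: nochar; exists p.
have [p pP vp] := residue_char Hv hs' (fun n => rpred_nat K' n).
have [m m0 hm] := residue_power Hv hs' pP vp.
(* Discreteness of the valuation: a power of |pi0| below 1 has a positive exponent. *)
have le_pi x : x \in K' -> v x < 1 -> v x <= v pi0.
  move=> xK; have [->|x0] := eqVneq x 0; first by rewrite v0 // v_ge0.
  have [[] k ->] := hpi x xK x0.
    case: k => [|k]; first by rewrite expr0z ltxx.
    by rewrite -exprnP exprS ler_piMr ?v_ge0 // exprn_ile1 ?v_ge0 // ltW.
  rewrite NegzE -exprnN ltNge invf_ge1 ?exprn_gt0 // exprn_ile1 ?v_ge0 //; exact: ltW.
have [e ve] : exists e, v p%:R = v pi0 ^+ e.
  have pR : p%:R != 0 :> Om by rewrite (pcharf0P _).1 // -lt0n prime_gt0.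
  have [[] k hk] := hpi _ (rpred_nat K' p) pR; first by exists k.
  move: vp; rewrite hk NegzE -exprnN ltNge invf_ge1 ?exprn_gt0 // exprn_ile1 ?v_ge0 //.
  exact: ltW.
have big_gal := galois_uniform Hv char0 pP vp pi_gt0 ve le_pi.
have Kc u : (forall n, u n \in K') -> cauchy v u -> exists2 l, l \in K' & cvg_to v u l.
  exact: K_complete.
apply: (monomial_special Hv char0); first by have [x [_ [y hy]]] := hinf [::]; exists x, y.
apply: (monomial_of_wild_values Hv char0 pP vp Kc fK' f0 big_gal).
(* Either special values occur at arbitrarily wild roots of unity, or some level m1 is never reached
   and the tame argument produces wild ones, with C large enough for both [big_gal] and m1. *)
have [//|/existsNP[m1 hm1]] := pselect (forall m, exists x, wild_of_level p m x /\
  exists y, special_value v f x y).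
apply: (wild_values_of_tame Hv char0 pP vp Kc fK' f0 big_gal v_complete m0 hm
  (C := maxn (e + 3) m1) (leq_maxl _ _) (leq_maxr _ _) hinf).
by move=> x y hxy xw; apply: hm1; exists x; split=> //; exists y.
Qed.
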